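(* Let $\beta>1$, $\mathbf{b}\in\mathbb{C}^n\setminus\{0\}$ and $L\in Q_{\mathbf{b},\beta}(\mathbb{B}_n)$. A function $F$ analytic in $\mathbb{B}_n$ is of bounded $L$-index in the direction $\mathbf{b}$ if and only if for any $r_1$ and $r_2$ with $0<r_1<r_2\le\beta$ there exists a number $P_1=P_1(r_1,r_2)\ge 1$ such that for each $z^0\in\mathbb{B}_n$ and each $t_0\in S_{z^0}$ $$\max\Big\{|F(z^0+t\mathbf{b})|:\ |t-t_0|=\tfrac{r_2}{L(z^0+t_0\mathbf{b})}\Big\}\le P_1\max\Big\{|F(z^0+t\mathbf{b})|:\ |t-t_0|=\tfrac{r_1}{L(z^0+t_0\mathbf{b})}\Big\}.$$
   Context: $|\cdot|$ is the Euclidean norm on $\mathbb{C}^n$, $\mathbb{B}_n=\{z\in\mathbb{C}^n:|z|<1\}$, $\mathbb{R}_+=(0,\infty)$, $\mathbb{Z}_+=\{0,1,2,\dots\}$. For $z\in\mathbb{C}^n$, $S_z=\{t\in\mathbb{C}: z+t\mathbf{b}\in\mathbb{B}_n\}$. Directional derivatives: $\frac{\partial^0F}{\partial\mathbf{b}^0}=F$, $\frac{\partial F}{\partial\mathbf{b}}=\sum_{j=1}^n\frac{\partial F}{\partial z_j}b_j$, $\frac{\partial^kF}{\partial\mathbf{b}^k}=\frac{\partial}{\partial\mathbf{b}}\big(\frac{\partial^{k-1}F}{\partial\mathbf{b}^{k-1}}\big)$ for $k\ge2$. For a positive continuous $L$ on $\mathbb{B}_n$, an analytic function $F$ in $\mathbb{B}_n$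 is of bounded $L$-index in the direction $\mathbf{b}$ if there is $m_0\in\mathbb{Z}_+$ such that for all $m\in\mathbb{Z}_+$ and all $z\in\mathbb{B}_n$ $$\frac{1}{m!L^m(z)}\left|\frac{\partial^mF(z)}{\partial\mathbf{b}^m}\right|\le\max\left\{\frac{1}{k!L^k(z)}\left|\frac{\partial^kF(z)}{\partial\mathbf{b}^k}\right|:0\le k\le m_0\right\}.$$ Class $Q_{\mathbf{b},\beta}(\mathbb{B}_n)$: the set of continuous $L:\mathbb{B}_n\to\mathbb{R}_+$ with $L(z)>\frac{\beta|\mathbf{b}|}{1-|z|}$ for all $z\in\mathbb{B}_n$ and such that $0<\lambda_1^{\mathbf{b}}(\eta)\le\lambda_2^{\mathbf{b}}(\eta)<+\infty$ for every $\eta\in[0,\beta]$, where $\lambda_1^{\mathbf{b}}(\eta)$ and $\lambda_2^{\mathbf{b}}(\eta)$ are respectively the infimum and the supremum of $\frac{L(z+t\mathbf{b})}{L(z+t_0\mathbf{b})}$ over all $z\in\mathbb{B}_n$, $t_0\in S_z$ and $t\in\mathbb{C}$ with $|t-t_0|\le\frac{\eta}{L(z+t_0\mathbf{b})}$ (for such $t$ one has $z+t\mathbf{b}\in\mathbb{B}_n$). *)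

(* Defs.v *)
(* MathComp-Analysis, with the complex numbers R[i] of mathcomp-real-closed. *)
From HB Require Import structures.
From mathcomp Require Import all_boot all_order all_algebra.
From mathcomp Require Import finmap complex.
From mathcomp Require Import all_classical all_reals all_analysis.
Set Implicit Arguments.
Unset Strict Implicit.
Unset Printing Implicit Defensive.
Import Order.TTheory GRing.Theory Num.Theory numFieldNormedType.Exports.
Local Open Scope classical_set_scope.
Local Open Scope ring_scope.

(* R[i]^o is R[i]; MathComp-Analysis puts its topology and its structure of
   normed space over the field R[i] on this alias. *)
Notation Cplx R := (R[i]%C^o).
Notation CVec R n := ('rV[Cplx R]_n).

(* The modulus of a complex number as an element of R (the norm `|x| of R[i]
   takes its values in R[i]). *)
Definition cabs {R : realType} (x : Cplx R) : R := ComplexField.Normc.normc x.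

Definition enorm {R : realType} {n : nat} (z : CVec R n) : R :=
  Num.sqrt (\sum_(j < n) cabs (z 0 j) ^+ 2).

(* The library norm on row vectors is the maximum norm, so its [ball] is a
   polydisc; it only serves for the topology. *)
Definition unit_ball (R : realType) (n : nat) : set (CVec R n) :=
  [set z | enorm z < 1].
Arguments unit_ball : clear implicits.

(* Unordered summability; for complex families it is absolute summability. *)
Definition has_sum {R : realType} {I : choiceType} (f : I -> Cplx R)
    (s : Cplx R) : Prop :=
  forall e : R, 0 < e -> exists A0 : {fset I},
    forall A : {fset I}, (A0 `<=` A)%fset ->
      cabs (s - \sum_(i <- A) f i) < e.

(* Near every point of D, F is the sum of a power series in n variables,
   indexed by the multi-indices alpha. *)
Definition analytic_in {R : realType} {n : nat} (D : set (CVec R n))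
    (F : CVec R n -> Cplx R) : Prop :=
  forall a, D a -> exists c : {ffun 'I_n -> nat} -> Cplx R,
    \forall z \near a,
      has_sum (fun alpha : {ffun 'I_n -> nat} =>
                 c alpha * \prod_(j < n) ((z : CVec R n) 0 j - a 0 j) ^+ alpha j) (F z).

Definition partial {R : realType} {n : nat} (j : 'I_n)
    (F : CVec R n -> Cplx R) : CVec R n -> Cplx R :=
  fun z => 'D_(delta_mx 0 j : CVec R n) F z.

Definition dirD {R : realType} {n : nat} (b : CVec R n)
    (F : CVec R n -> Cplx R) : CVec R n -> Cplx R :=
  fun z => \sum_(j < n) partial j F z * b 0 j.

Definition dirDn {R : realType} {n : nat} (b : CVec R n) (k : nat)
    (F : CVec R n -> Cplx R) : CVec R n -> Cplx R :=
  iter k (dirD b) F.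

Definition slice {R : realType} {n : nat} (b z : CVec R n) : set (Cplx R) :=
  [set t | unit_ball R n (z + t *: b)].

Definition index_term {R : realType} {n : nat} (b : CVec R n)
    (L : CVec R n -> R) (F : CVec R n -> Cplx R) (k : nat) (z : CVec R n) : R :=
  (k`!%:R * L z ^+ k)^-1 * cabs (dirDn b k F z).

(* All the index terms are nonnegative where L > 0, so that 0 is a neutral
   starting value for the maximum. *)
Definition bounded_index {R : realType} {n : nat} (b : CVec R n)
    (L : CVec R n -> R) (F : CVec R n -> Cplx R) : Prop :=
  exists m0 : nat, forall (m : nat) (z : CVec R n), unit_ball R n z ->
    index_term b L F m z <=
      \big[Num.max/0]_(k < m0.+1) index_term b L F k z.

Definition ratio_set {R : realType} {n : nat} (b : CVec R n)
    (L : CVec R n -> R) (eta : R) : set (\bar R) :=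
  [set q | exists (z : CVec R n) (t0 t : Cplx R),
     [/\ unit_ball R n z, slice b z t0,
         cabs (t - t0) <= eta / L (z + t0 *: b) &
         q = (L (z + t *: b) / L (z + t0 *: b))%:E]].

Definition lambda1 {R : realType} {n : nat} (b : CVec R n)
    (L : CVec R n -> R) (eta : R) : \bar R := ereal_inf (ratio_set b L eta).

Definition lambda2 {R : realType} {n : nat} (b : CVec R n)
    (L : CVec R n -> R) (eta : R) : \bar R := ereal_sup (ratio_set b L eta).

(* L is a total function, of which only the values on the ball matter. *)
Definition Qclass {R : realType} {n : nat} (b : CVec R n) (beta : R)
    (L : CVec R n -> R) : Prop :=
  [/\ {within unit_ball R n, continuous L},
      forall z, unit_ball R n z -> 0 < L z,
      forall z, unit_ball R n z -> beta * enorm b / (1 - enorm z) < L z &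
      forall eta, 0 <= eta <= beta ->
        [/\ (0 < lambda1 b L eta)%E, (lambda1 b L eta <= lambda2 b L eta)%E &
            (lambda2 b L eta < +oo)%E]].

(* For F continuous on the circle |t - t0| = rho, which is compact and
   nonempty when 0 <= rho, the supremum below is attained: it is the maximum. *)
Definition circle_max {R : realType} {n : nat} (b : CVec R n)
    (F : CVec R n -> Cplx R) (z0 : CVec R n) (t0 : Cplx R) (rho : R) : R :=
  sup [set cabs (F (z0 + t *: b)) | t in [set t | cabs (t - t0) = rho]].

(* Main.v *)
(* Everything happens on the slices g(h) = F(w + h b), whose Taylor coefficients
   at 0 are the derivatives of F along b at w divided by k!.  Cauchy's estimates
   come without integration from the maximum principle, applied to the average
   of g over rotations by roots of unity divided by a power of h.

   If the index is bounded, let A(w) be the maximum of the index terms at w.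
   The Taylor series gives |F| <= 2 A(w) on the disc of radius 1/(2 L(w)), and
   Cauchy's estimates around a point w' with |w' - w| <= |b|/(4 L(w)) on the
   slice give A(w') <= K A(w).  A bounded number of such steps crosses the disc
   of radius beta/L(w), and A(w) is bounded by the maximum on the circle of
   radius r1/L(w), again by Cauchy.

   Conversely, let M(r) be the maximum on the circle of radius r/L(w), and
   suppose M(beta) <= P M(1).  The m-th index term is at most P M(1)/beta^m, and
   the Taylor remainder of order N on |h| = 1/L(w) is at most
   (N + 1) P M(1)/beta^N <= M(1)/2 for N large; so M(1) is at most twice the sum
   of the first N index terms, which therefore dominate all the later ones. *)
Require Import Defs.
From mathcomp Require Import all_boot all_order all_algebra.
From mathcomp Require Import cyclic separable cyclotomic finmap complex.
From mathcomp Require Import all_classical all_reals all_analysis.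
From mathcomp Require Import ring lra.
Import Order.TTheory GRing.Theory Num.Theory numFieldNormedType.Exports.
Set Implicit Arguments.
Unset Strict Implicit.
Unset Printing Implicit Defensive.
Local Open Scope classical_set_scope.
Local Open Scope ring_scope.

(** * Complex modulus and roots of unity *)

Section Modulus.
Variable R : realType.
Local Notation C := (Cplx R).
Implicit Types (x y : C) (r : R).

Definition ofR r : C := r%:C%C.

Lemma ofR1 : ofR 1 = 1. Proof. by []. Qed.

Lemma ofRD r s : ofR (r + s) = ofR r + ofR s.
Proof. exact: (rmorphD (real_complex R)). Qed.

Lemma ofR_nat m : ofR m%:R = m%:R.
Proof. exact: (rmorph_nat (real_complex R)). Qed.

Lemma sqr_cabs x : cabs x ^+ 2 = complex.Re x ^+ 2 + complex.Im x ^+ 2.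
Proof. by case: x => a b; rewrite /cabs /= sqr_sqrtr// addr_ge0 ?sqr_ge0. Qed.

Lemma cabs_ge0 x : 0 <= cabs x.
Proof. by case: x => a b; exact: sqrtr_ge0. Qed.

Lemma normE x : `|x| = ofR (cabs x).
Proof. by case: x. Qed.

Lemma cabs0 : cabs (0 : C) = 0.
Proof. exact: ComplexField.Normc.normc0. Qed.

Lemma cabs1 : cabs (1 : C) = 1.
Proof. exact: ComplexField.Normc.normc1. Qed.

Lemma cabsM x y : cabs (x * y) = cabs x * cabs y.
Proof. exact: ComplexField.Normc.normcM. Qed.

Lemma cabsV x : cabs x^-1 = (cabs x)^-1.
Proof. exact: ComplexField.Normc.normcV. Qed.

Lemma cabsf x y : cabs (x / y) = cabs x / cabs y.
Proof. by rewrite cabsM cabsV. Qed.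

Lemma cabsN x : cabs (- x) = cabs x.
Proof. exact: normcN. Qed.

Lemma cabsX x m : cabs (x ^+ m) = cabs x ^+ m.
Proof. by elim: m => [|m IH]; rewrite ?expr0 ?cabs1// !exprS cabsM IH. Qed.

Lemma cabsD x y : cabs (x + y) <= cabs x + cabs y.
Proof. exact: le_normcD. Qed.

Lemma cabsB x y : cabs (x - y) <= cabs x + cabs y.
Proof. by rewrite -[cabs y]cabsN; exact: cabsD. Qed.

Lemma cabs_distC x y : cabs (x - y) = cabs (y - x).
Proof. by rewrite -cabsN opprB. Qed.

Lemma cabs_le_dist x y : cabs x <= cabs y + cabs (x - y).
Proof. by have := cabsD y (x - y); rewrite addrC subrK. Qed.

Lemma cabs_eq0 x : (cabs x == 0) = (x == 0).
Proof.
apply/eqP/eqP => [|->]; [exact: ComplexField.Normc.eq0_normc|exact: cabs0].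
Qed.

Lemma cabs_gt0 x : (0 < cabs x) = (x != 0).
Proof. by rewrite lt_def cabs_ge0 andbT cabs_eq0. Qed.

Lemma cabs_ofR r : cabs (ofR r) = `|r|.
Proof. by rewrite /cabs /= expr0n /= addr0 sqrtr_sqr. Qed.

Lemma cabs_nat m : cabs (m%:R : C) = m%:R.
Proof. by rewrite -ofR_nat cabs_ofR ger0_norm. Qed.

Lemma Re_le_cabs x : `|complex.Re x| <= cabs x.
Proof.
by rewrite -ler_sqr ?nnegrE ?cabs_ge0// sqr_cabs real_normK ?num_real// lerDl sqr_ge0.
Qed.

Lemma Im_le_cabs x : `|complex.Im x| <= cabs x.
Proof.
by rewrite -ler_sqr ?nnegrE ?cabs_ge0// sqr_cabs real_normK ?num_real// lerDr sqr_ge0.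
Qed.

Lemma cabs_le_ReIm x : cabs x <= `|complex.Re x| + `|complex.Im x|.
Proof.
rewrite -ler_sqr ?nnegrE ?addr_ge0 ?cabs_ge0// sqr_cabs sqrrD !real_normK ?num_real//.
by rewrite lerD2r lerDl mulrn_wge0 ?mulr_ge0.
Qed.

Lemma cabs_sum (I : Type) (s : seq I) (P : pred I) (f : I -> C) :
  cabs (\sum_(i <- s | P i) f i) <= \sum_(i <- s | P i) cabs (f i).
Proof.
elim/big_ind2 : _ => [|x u y v hx hy|//]; first by rewrite cabs0.
by rewrite (le_trans (cabsD _ _))// lerD.
Qed.

(** ['X^m - 1] splits over the algebraically closed field [R[i]] and is separable in characteristic
    0; among its [m] distinct roots there is a primitive one. *)
Lemma exists_primitive_root m : (0 < m)%N -> exists w : C, m.-primitive_root w.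
Proof.
pose p : {poly R[i]} := 'X^m - 1; have [r Dp] := closed_field_poly_normal p.
move=> m_gt0; rewrite (monicP _) ?monicXnsubC // scale1r in Dp.
have rn1 : all m.-unity_root r by apply/allP=> z; rewrite -root_prod_XsubC -Dp.
have sz_r : (m < (size r).+1)%N.
  by rewrite -(size_prod_XsubC r id) -Dp size_XnsubC.
have [|z] := hasP (has_prim_root m_gt0 rn1 _ sz_r); last by exists z.
by rewrite -separable_prod_XsubC -Dp separable_Xn_sub_1 // pnatr_eq0 -lt0n.
Qed.

Lemma cabs_primitive_root m (w : C) : m.-primitive_root w -> cabs w = 1.
Proof.
move=> hw; have := congr1 cabs (prim_expr_order hw); rewrite cabsX cabs1 => /eqP.
by rewrite pexpr_eq1 ?cabs_ge0 ?(prim_order_gt0 hw)// => /eqP.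
Qed.

(** A geometric sum of ratio [w ^+ k], which differs from 1: multiplied by [w ^+ k - 1] it
    telescopes to 0. *)
Lemma sum_primitive_root m (w : C) k : m.-primitive_root w -> ~~ (m %| k)%N ->
  \sum_(j < m) w ^+ (k * j) = 0.
Proof.
move=> hw mk; have wk1 : w ^+ k - 1 != 0.
  by rewrite subr_eq0 -(prim_order_dvd hw).
apply: (mulfI wk1); rewrite mulr0.
under eq_bigr do rewrite exprM.
by rewrite -subrX1 -exprM mulnC exprM (prim_expr_order hw) expr1n subrr.
Qed.
End Modulus.

(** * Maximum principle and Cauchy estimates *)

Section Compactness.
Variable R : realType.
Local Notation C := (Cplx R).

(** The disc is carried over to [R * R], where it is a closed part of a compact square; continuity
    is phrased through [cabs], the form in which expansions provide it. *)
Lemma disc_max (phi : C -> R) (r : R) : 0 <= r ->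
  (forall a, cabs a <= r -> forall e, 0 < e -> exists2 d, 0 < d &
     forall h, cabs h < d -> `|phi (a + h) - phi a| < e) ->
  exists2 a, cabs a <= r & forall s, cabs s <= r -> phi s <= phi a.
Proof.
move=> r0 hphi.
pose tr (p : R * R) : C := Complex p.1 p.2.
pose A : set (R * R) := [set p | p.1 ^+ 2 + p.2 ^+ 2 <= r ^+ 2].
have trA p : A p <-> cabs (tr p) <= r.
  have hs : (cabs (tr p) ^+ 2 <= r ^+ 2) = (cabs (tr p) <= r).
    by apply: ler_sqr; rewrite nnegrE ?cabs_ge0.
  by rewrite -hs sqr_cabs.
have A0 : A !=set0 by exists (0, 0); rewrite /A /= expr0n /= addr0 sqr_ge0.
have cA : compact A.
  apply: (@subclosed_compact _ _ (`[-r, r] `*` `[-r, r])).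
  - rewrite (_ : A = (fun p : R * R => p.1 ^+ 2 + p.2 ^+ 2) @^-1` [set x | x <= r ^+ 2])//.
    move: (@closed_le R (r ^+ 2)); apply: (continuous_closedP _).1 => p.
    apply: cvgD; apply: (@continuous_comp _ _ _ _ (fun x : R => x ^+ 2));
      try exact: exprn_continuous.
      exact: cvg_fst.
    exact: cvg_snd.
  - by apply: compact_setX; exact: segment_compact.
  - move=> [x y]; rewrite /A /= => h; split => /=; rewrite in_itv /= -ler_norml;
      rewrite -ler_sqr ?nnegrE// real_normK ?num_real//; apply: le_trans h.
      by rewrite lerDl sqr_ge0.
    by rewrite lerDr sqr_ge0.
have [|[x y] xyA hmax] := @compact_EVT_max _ R (phi \o tr) A A0 cA.
  apply: continuous_in_subspaceT => -[x y]; rewrite inE => /trA hxy.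
  apply/cvgrPdist_lt => e e0 /=.
  have [d d0 hd] := hphi _ hxy e e0.
  (* Half of [d] per coordinate, since [cabs] is at most the sum of the absolute values of the two
     coordinates. *)
  exists (ball x (d / 2), ball y (d / 2)).
    by split; apply: nbhsx_ballx; rewrite divr_gt0.
  move=> [u v] [/= hu hv]; rewrite distrC.
  rewrite (_ : tr (u, v) = tr (x, y) + Complex (u - x) (v - y) :> C); last first.
    by apply/eqP; rewrite eq_complex /= ![_ + (_ - _)]addrC !subrK !eqxx.
  apply: hd; apply: (le_lt_trans (cabs_le_ReIm _)) => /=.
  rewrite (splitr d); apply: ltrD; rewrite distrC; assumption.
exists (tr (x, y)); first by apply/trA; rewrite inE in xyA.
move=> [u v] huv; apply: (hmax (u, v)); rewrite inE; apply/trA; exact: huv.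
Qed.
End Compactness.

(** * Asymptotic expansions and division by the variable *)

Section Expansions.
Variable R : realType.
Local Notation C := (Cplx R).
Implicit Types (g : C -> C) (a h s w : C) (c : nat -> C) (r M : R).

(* Asymptotic expansions to all orders: convergence of the Taylor series is not
   asked for, but recovered in [taylor_remainder]. *)
Definition expands g a c := forall m : nat, exists B d : R,
  [/\ 0 <= B, 0 < d & forall h, cabs h < d ->
    cabs (g (a + h) - \sum_(k < m) c k * h ^+ k) <= B * cabs h ^+ m].

Definition expandable r g := forall a, cabs a <= r -> exists c, expands g a c.

Lemma expands_ext g g' a c c' : g =1 g' -> c =1 c' ->
  expands g a c -> expands g' a c'.
Proof. by move=> /funext <- /funext <-. Qed.

(** At order 1 and [h = 0] the error bound is 0. *)
Lemma expands_at g a c : expands g a c -> g a = c 0%N.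
Proof.
move=> /(_ 1%N) [B [d [B0 d0]]] /(_ 0); rewrite cabs0 => /(_ d0).
rewrite big_ord1 expr0 mulr1 expr1 mulr0 addr0 => h.
by apply/eqP; rewrite -subr_eq0 -cabs_eq0 eq_le h cabs_ge0.
Qed.

Lemma expandsD g1 g2 a c1 c2 : expands g1 a c1 -> expands g2 a c2 ->
  expands (fun s => g1 s + g2 s) a (fun k => c1 k + c2 k).
Proof.
move=> h1 h2 m; have [B1 [d1 [B10 d10 {}h1]]] := h1 m.
have [B2 [d2 [B20 d20 {}h2]]] := h2 m.
exists (B1 + B2), (Num.min d1 d2); split; rewrite ?addr_ge0 ?lt_min ?d10// => h.
rewrite lt_min => /andP[/h1 {}h1 /h2 {}h2].
under eq_bigr do rewrite mulrDl.
rewrite big_split /= opprD addrACA mulrDl.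
by rewrite (le_trans (cabsD _ _))// lerD.
Qed.

Lemma expandsZ g a c w : expands g a c ->
  expands (fun s => w * g s) a (fun k => w * c k).
Proof.
move=> hg m; have [B [d [B0 d0 {}hg]]] := hg m.
exists (cabs w * B), d; split; rewrite ?mulr_ge0 ?cabs_ge0// => h /hg {}hg.
under eq_bigr do rewrite -mulrA.
by rewrite -mulr_sumr -mulrBr cabsM -mulrA ler_wpM2l// cabs_ge0.
Qed.

Lemma expands_cst a w : expands (fun=> w) a (fun k => if k is 0%N then w else 0).
Proof.
case=> [|m].
  exists (cabs w), 1; split; rewrite ?cabs_ge0// => h _.
  by rewrite big_ord0 subr0 expr0 mulr1.
exists 0, 1; split => // h _; rewrite big_ord_recl expr0 mulr1 /= big1 => [|i _].
  by rewrite addr0 subrr cabs0 mul0r.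
by rewrite mul0r.
Qed.

Lemma expands_sum (I : Type) (t : seq I) (f : I -> C -> C) a (c : I -> nat -> C) :
  (forall j, expands (f j) a (c j)) ->
  expands (fun s => \sum_(j <- t) f j s) a (fun k => \sum_(j <- t) c j k).
Proof.
move=> hf; elim: t => [|j t IH].
  apply: expands_ext (@expands_cst a 0) => [s|[|k]]; by rewrite big_nil.
apply: expands_ext (expandsD (hf j) IH) => [s|k]; by rewrite big_cons.
Qed.

Lemma expands_rot g a c w : cabs w = 1 -> expands g (w * a) c ->
  expands (fun s => g (w * s)) a (fun k => c k * w ^+ k).
Proof.
move=> w1 hg m; have [B [d [B0 d0 {}hg]]] := hg m; exists B, d; split => // h hd.
have := hg (w * h); rewrite cabsM w1 mul1r => /(_ hd).
rewrite mulrDr => {}hg.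
under eq_bigr do rewrite -mulrA -exprMn.
exact: hg.
Qed.

(** The value [w] fills the removable singularity at 0; when [g] vanishes there, the right [w] is
    the first coefficient of [g]. *)
Definition quot0 g w s : C := if s == 0 then w else g s / s.

Lemma expands_quot0 g c : expands g 0 c -> c 0%N = 0 ->
  expands (quot0 g (c 1%N)) 0 (fun k => c k.+1).
Proof.
move=> hg c0 m; have [B [d [B0 d0 {}hg]]] := hg m.+1.
(* The extra [cabs (c 1%N)] covers [h = 0] at order 0, where the quotient is [c 1%N] itself. *)
exists (B + cabs (c 1%N)), d; split; rewrite ?addr_ge0 ?cabs_ge0// => h hd.
rewrite /quot0 add0r; case: ifPn => [/eqP ->|hn0].
  case: m {hg} => [|m].
    by rewrite big_ord0 subr0 expr0 mulr1 lerDr.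
  rewrite big_ord_recl expr0 mulr1 big1 => [|i _]; last by rewrite expr0n /= mulr0.
  by rewrite addr0 subrr cabs0 mulr_ge0 ?addr_ge0 ?cabs_ge0// exprn_ge0.
have := hg _ hd; rewrite add0r big_ord_recl c0 mul0r add0r => {}hg.
have -> : g h / h - \sum_(k < m) c k.+1 * h ^+ k =
    (g h - \sum_(i < m) c (lift ord0 i) * h ^+ lift ord0 i) / h.
  rewrite mulrBl mulr_suml; congr (_ - _); apply: eq_bigr => i _.
  by rewrite /= /bump /= add1n exprSr mulrA mulfK.
rewrite cabsf ler_pdivrMr ?cabs_gt0// -mulrA -exprSr (le_trans hg)//.
by rewrite ler_wpM2r ?exprn_ge0 ?cabs_ge0// lerDl cabs_ge0.
Qed.

Lemma expands_quot g a c w : a != 0 -> expands g a c ->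
  exists c', expands (quot0 g w) a c'.
Proof.
move=> an0 hg.
(* Long division of the series [c] by [a + h]: [e m.+1] is the m-th coefficient of the quotient. The
   value [e 0 = 0] only starts the recursion, and [e m * h ^+ m] is the remainder in [key]. *)
pose e := fix e m := if m is m.+1 then (c m - e m) / a else 0.
have key h m : (a + h) * (\sum_(k < m) e k.+1 * h ^+ k) =
    \sum_(k < m) c k * h ^+ k + e m * h ^+ m.
  elim: m => [|m IH]; first by rewrite !big_ord0 mulr0 mul0r addr0.
  rewrite !big_ord_recr /= mulrDr IH exprS.
  by field.
exists (fun k => e k.+1) => m; have [B [d [B0 d0 {}hg]]] := hg m.
have a0 : 0 < cabs a by rewrite cabs_gt0.
(* For [cabs h < cabs a / 2] the divisor [a + h] has modulus at least [cabs a / 2]. *)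
exists ((B + cabs (e m)) / (cabs a / 2)), (Num.min d (cabs a / 2)); split.
- by rewrite divr_ge0 ?addr_ge0 ?cabs_ge0// divr_ge0// ltW.
- by rewrite lt_min d0 divr_gt0.
move=> h; rewrite lt_min => /andP[/hg {}hg ha].
have ah : cabs a / 2 <= cabs (a + h).
  have := cabsB (a + h) h; rewrite addrK; lra.
have ahn0 : a + h != 0 by rewrite -cabs_gt0 (lt_le_trans _ ah)// divr_gt0.
rewrite /quot0 (negbTE ahn0).
have -> : g (a + h) / (a + h) - \sum_(k < m) e k.+1 * h ^+ k =
   (g (a + h) - \sum_(k < m) c k * h ^+ k - e m * h ^+ m) / (a + h).
  by rewrite -addrA -opprD -key; field.
rewrite cabsf ler_pdivrMr ?cabs_gt0//.
apply: (@le_trans _ _ ((B + cabs (e m)) * cabs h ^+ m)).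
  rewrite (le_trans (cabsB _ _))// mulrDl cabsM cabsX lerD2r//.
rewrite (_ : _ / _ * _ * _ = (B + cabs (e m)) * cabs h ^+ m *
  (cabs (a + h) / (cabs a / 2))); last by ring.
rewrite ler_peMr ?mulr_ge0 ?exprn_ge0 ?addr_ge0 ?cabs_ge0//.
by rewrite ler_pdivlMr ?divr_gt0// mul1r.
Qed.

(* Remove the constant term, divide by [s], repeat. *)
Lemma expandable_factor r g c m : 0 <= r -> expandable r g -> expands g 0 c ->
  exists q, [/\ expandable r q, expands q 0 (fun k => c (m + k)%N) &
    forall s, g s = \sum_(k < m) c k * s ^+ k + s ^+ m * q s].
Proof.
move=> r0 hg hc; elim: m => [|m [q [hq hqc gq]]].
  by exists g; split => // s; rewrite big_ord0 add0r expr0 mul1r.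
pose q' s := q s + - c m.
have hq'c : expands q' 0 (fun k => if k is 0%N then 0 else c (m + k)%N).
  apply: expands_ext (expandsD hqc (@expands_cst 0 (- c m))) => // -[|k] /=.
    by rewrite addn0 subrr.
  by rewrite addr0.
exists (quot0 q' (c m.+1)); split.
- move=> a ar; have [->|an0] := eqVneq a 0.
    by eexists; have := expands_quot0 hq'c erefl; rewrite /= addn1; apply.
  have [c1 hc1] := hq a ar.
  have := expandsD hc1 (@expands_cst a (- c m)).
  exact: expands_quot.
- have := expands_quot0 hq'c erefl; rewrite /= addn1.
  by apply: expands_ext => // k; rewrite addnS.
move=> s; rewrite gq big_ord_recr /= -addrA; congr (_ + _).
rewrite /quot0; case: ifPn => [/eqP ->|sn0].
  rewrite exprS mul0r mul0r addr0 mulrC (expands_at hqc) addn0//.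
by rewrite /q' exprSr; field.
Qed.
End Expansions.

Section MaximumModulus.
Variable R : realType.
Local Notation C := (Cplx R).
Implicit Types (g : C -> C) (a s : C) (c : nat -> C) (r M : R).

Lemma sqr_dist_le (x y D : R) : 0 <= x -> 0 <= y -> `|x - y| <= D ->
  `|x ^+ 2 - y ^+ 2| <= D * (2 * y + D).
Proof.
move=> x0 y0 hD; rewrite subr_sqr normrM ler_pM//.
rewrite ger0_norm ?addr_ge0//; have := ler_norm (x - y); lra.
Qed.

Lemma cabs_dist_le (x y : C) : `|cabs x - cabs y| <= cabs (x - y).
Proof.
rewrite ler_norml; have := cabs_le_dist x y; have := cabs_le_dist y x.
rewrite (cabs_distC y x); lra.
Qed.

Lemma expandable_lipschitz r g a : expandable r g -> cabs a <= r ->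
  exists B d, [/\ 0 <= B, 0 < d &
    forall h, cabs h < d -> cabs (g (a + h) - g a) <= B * cabs h].
Proof.
move=> hg /hg[c hc]; have ga := expands_at hc.
have [B [d [B0 d0 hB]]] := hc 1%N; exists B, d; split => // h /hB.
by rewrite big_ord1 expr0 mulr1 expr1 ga.
Qed.

Lemma expandable_bounded r g : 0 <= r -> expandable r g ->
  exists M, forall s, cabs s <= r -> cabs (g s) <= M.
Proof.
move=> r0 hg.
have [|a _ amax] := disc_max (phi := fun s => cabs (g s)) r0; last first.
  by exists (cabs (g a)) => s; exact: amax.
move=> a ar e e0; have [B [d [B0 d0 hB]]] := expandable_lipschitz hg ar.
have B10 : 0 < B + 1 by rewrite ltr_wpDl.
exists (Num.min d (e / (B + 1))); first by rewrite lt_min d0 divr_gt0.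
move=> h; rewrite lt_min => /andP[/hB {}hB]; rewrite ltr_pdivlMr//.
apply: le_lt_trans; rewrite (le_trans (cabs_dist_le _ _))// (le_trans hB)//.
by rewrite mulrC ler_wpM2l ?cabs_ge0// lerDl.
Qed.

(* The maximum of [|g|^2 + eps |s|^2] over the closed disc is not attained
   inside: at an interior point [a], averaging over [a + h] with
   [h = t, it, -t, -it] cancels the cross terms of the second-order expansion
   of [g], and leaves a gain of at least [eps t^2 - O(t^3)]. *)
Lemma maximum_modulus g r M : 0 <= r -> expandable r g ->
  (forall s, cabs s = r -> cabs (g s) <= M) ->
  forall s, cabs s <= r -> cabs (g s) <= M.
Proof.
move=> r0 hg hM s sr.
have M0 : 0 <= M.
  by apply: le_trans (hM (ofR r) _); rewrite ?cabs_ge0// cabs_ofR ger0_norm.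
rewrite -ler_sqr ?nnegrE ?cabs_ge0//; apply/ler_addgt0Pr => e e0.
(* On the circle the perturbation then costs at most [e]; adding 1 keeps the denominator positive
   when [r = 0]. *)
pose eps := e / (r ^+ 2 + 1).
have r21 : 0 < r ^+ 2 + 1 by rewrite ltr_wpDl ?sqr_ge0.
have eps0 : 0 < eps by rewrite divr_gt0.
have epsr : eps * r ^+ 2 <= e.
  by rewrite /eps mulrAC ler_pdivrMr// ler_pM2l// lerDl.
pose phi (s : C) := cabs (g s) ^+ 2 + eps * cabs s ^+ 2.
have [a ar amax] : exists2 a, cabs a <= r & forall s, cabs s <= r -> phi s <= phi a.
  apply: disc_max => // a ar e1 e10.
  have [B [d [B0 d0 hB]]] := expandable_lipschitz hg ar.
  pose K := B * (2 * cabs (g a) + B) + eps * (2 * cabs a + 1).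
  have K0 : 0 <= K.
    have := cabs_ge0 (g a); have := cabs_ge0 a => a0 ga0.
    by apply: addr_ge0; apply: mulr_ge0 => //; lra.
  exists (Num.min (Num.min d 1) (e1 / (K + 1))).
    by rewrite !lt_min d0 ltr01 divr_gt0// ltr_wpDl.
  move=> h; rewrite !lt_min => /andP[/andP[hd h1]]; rewrite ltr_pdivlMr ?ltr_wpDl// => hK.
  apply: le_lt_trans hK; rewrite mulrC.
  have h0 := cabs_ge0 h.
  have E1 : `|cabs (g (a + h)) ^+ 2 - cabs (g a) ^+ 2| <=
      B * cabs h * (2 * cabs (g a) + B * cabs h).
    apply: sqr_dist_le; rewrite ?cabs_ge0//.
    by rewrite (le_trans (cabs_dist_le _ _))// hB.
  have E2 : `|cabs (a + h) ^+ 2 - cabs a ^+ 2| <= cabs h * (2 * cabs a + cabs h).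
    apply: sqr_dist_le; rewrite ?cabs_ge0//.
    by rewrite (le_trans (cabs_dist_le _ _))// addrAC subrr add0r.
  rewrite (_ : phi (a + h) - phi a = (cabs (g (a + h)) ^+ 2 - cabs (g a) ^+ 2) +
     eps * (cabs (a + h) ^+ 2 - cabs a ^+ 2)); last by rewrite /phi; ring.
  apply: (le_trans (ler_normD _ _)); rewrite normrM (gtr0_norm eps0).
  apply: (@le_trans _ _ (K * cabs h)); last first.
    by rewrite ler_wpM2r// lerDl.
  have E3 : B * cabs h * (2 * cabs (g a) + B * cabs h) <=
     B * (2 * cabs (g a) + B) * cabs h.
    rewrite [leRHS]mulrAC ler_wpM2l ?mulr_ge0// lerD2l.
    by rewrite -[leRHS]mulr1 ler_wpM2l// ltW.
  have E4 : eps * `|cabs (a + h) ^+ 2 - cabs a ^+ 2| <=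
      eps * (2 * cabs a + 1) * cabs h.
    rewrite -mulrA ler_pM2l// (le_trans E2)// mulrC ler_wpM2r//.
    by rewrite lerD2l ltW.
  by rewrite mulrDl lerD// (le_trans E1).
apply: (@le_trans _ _ (phi s)); first by rewrite lerDl mulr_ge0 ?sqr_ge0// ltW.
apply: (le_trans (amax _ sr)).
have [ar'|ar'] := eqVneq (cabs a) r.
  rewrite /phi ar' lerD// ler_sqr ?nnegrE ?cabs_ge0//; exact: hM.
have {}ar' : cabs a < r by rewrite lt_neqAle ar'.
exfalso.
have [c hc] := hg a ar; have ga := expands_at hc.
have [B [d [B0 d0 hB]]] := hc 3%N.
pose P (h : C) := c 0%N + c 1%N * h + c 2%N * h ^+ 2.
have {}hB h : cabs h < d -> cabs (g (a + h) - P h) <= B * cabs h ^+ 3.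
  move=> /hB; rewrite !big_ord_recr big_ord0 /= add0r expr0 mulr1 expr1.
  exact.
pose S := cabs (c 0%N) + cabs (c 1%N) + cabs (c 2%N).
have S0 : 0 <= S by rewrite !addr_ge0 ?cabs_ge0.
have SB0 : 0 <= S * B by exact: mulr_ge0.
(* The bounds keep [a + h] inside the disc and in the range of the expansion, give [t <= 1] so that
   [cabs (P h) <= S], and make the gain [eps * t ^+ 2] exceed the cubic error. *)
pose t := Num.min (Num.min (d / 2) (r - cabs a)) (Num.min 1 (eps / (4 * (S * B) + 1))).
have den0 : 0 < 4 * (S * B) + 1 by lra.
have t0 : 0 < t.
  rewrite !lt_min divr_gt0//= subr_gt0 ar'/= ltr01 divr_gt0//.
have td : t < d.
  apply: (@le_lt_trans _ _ (d / 2)); last lra.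
  by rewrite /t ge_min ge_min lexx.
have tr : t <= r - cabs a by rewrite /t !ge_min lexx orbT.
have t1 : t <= 1 by rewrite /t !ge_min lexx !orbT.
have teps : t * (4 * (S * B) + 1) <= eps.
  by rewrite -ler_pdivlMr// /t !ge_min lexx !orbT.
(* With [E = B * t ^+ 3] the bound on [cabs (g - P)], one has [|g|^2 >= |P|^2 - 2 |P| E], and
   [|P| <= S]. When [|P| <= E] the right-hand side is not positive. *)
have main h : cabs h = t ->
    cabs (P h) ^+ 2 - 2 * (S * B) * t ^+ 3 + eps * cabs (a + h) ^+ 2 <= phi a.
  move=> ht; have hd : cabs h < d by rewrite ht.
  apply: le_trans (amax (a + h) _); last first.
    by rewrite (le_trans (cabsD _ _))// ht; lra.
  rewrite lerD2r; have := hB h hd; rewrite ht => hE.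
  have PS : cabs (P h) <= S.
    rewrite (le_trans (cabsD _ _))// lerD//.
      rewrite (le_trans (cabsD _ _))// lerD// cabsM ht.
      by rewrite ler_piMr ?cabs_ge0.
    by rewrite cabsM cabsX ht ler_piMr ?cabs_ge0// exprn_ile1// ltW.
  have := cabs_le_dist (P h) (g (a + h)); rewrite cabs_distC => hP.
  have {}hP : cabs (P h) <= cabs (g (a + h)) + B * t ^+ 3 by rewrite (le_trans hP)// lerD2l.
  have Et0 : 0 <= B * t ^+ 3 by rewrite mulr_ge0// exprn_ge0// ltW.
  have hPE : cabs (P h) * (B * t ^+ 3) <= S * (B * t ^+ 3) by rewrite ler_wpM2r.
  have -> : 2 * (S * B) * t ^+ 3 = 2 * (S * (B * t ^+ 3)) by ring.
  apply: (@le_trans _ _ (cabs (P h) ^+ 2 - 2 * (cabs (P h) * (B * t ^+ 3)))).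
    lra.
  move: hP Et0; move: (B * t ^+ 3) => E hP E0.
  have p0 := cabs_ge0 (P h); have x0 := cabs_ge0 (g (a + h)).
  have [PE|PE] := leP (cabs (P h)) E.
    have := ler_wpM2l p0 PE; have := sqr_ge0 (cabs (g (a + h))).
    rewrite -[cabs (P h) * cabs (P h)]expr2 => A1 A2.
    have : 0 <= cabs (P h) * E by rewrite mulr_ge0.
    lra.
  have : (cabs (P h) - E) ^+ 2 <= cabs (g (a + h)) ^+ 2.
    rewrite ler_sqr ?nnegrE ?subr_ge0 ?(ltW PE)//; lra.
  rewrite sqrrB -mulr_natl; have := sqr_ge0 E; lra.
have sumP : cabs (P (Complex t 0)) ^+ 2 + cabs (P (Complex 0 t)) ^+ 2 +
    cabs (P (Complex (- t) 0)) ^+ 2 + cabs (P (Complex 0 (- t))) ^+ 2 =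
    4 * (cabs (c 0%N) ^+ 2 + cabs (c 1%N) ^+ 2 * t ^+ 2 + cabs (c 2%N) ^+ 2 * t ^+ 4).
  rewrite !sqr_cabs /P; case: (c 0%N) (c 1%N) (c 2%N) => [x0 y0] [x1 y1] [x2 y2].
  rewrite !expr2 /=; ring.
have suma : cabs (a + Complex t 0) ^+ 2 + cabs (a + Complex 0 t) ^+ 2 +
    cabs (a + Complex (- t) 0) ^+ 2 + cabs (a + Complex 0 (- t)) ^+ 2 =
    4 * (cabs a ^+ 2 + t ^+ 2).
  rewrite !sqr_cabs; case: (a) => [x0 y0] /=; ring.
have abs1 : cabs (Complex t 0 : C) = t.
  by rewrite /cabs /= expr0n addr0 sqrtr_sqr gtr0_norm.
have abs2 : cabs (Complex 0 t : C) = t.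
  by rewrite /cabs /= expr0n add0r sqrtr_sqr gtr0_norm.
have abs3 : cabs (Complex (- t) 0 : C) = t.
  by rewrite /cabs /= expr0n addr0 sqrtr_sqr normrN gtr0_norm.
have abs4 : cabs (Complex 0 (- t) : C) = t.
  by rewrite /cabs /= expr0n add0r sqrtr_sqr normrN gtr0_norm.
have := main _ abs1; have := main _ abs2; have := main _ abs3; have := main _ abs4.
rewrite /phi ga => F1 F2 F3 F4.
have c1t : 0 <= cabs (c 1%N) ^+ 2 * t ^+ 2 by rewrite mulr_ge0 ?sqr_ge0.
have c2t : 0 <= cabs (c 2%N) ^+ 2 * t ^+ 4.
  by rewrite mulr_ge0 ?sqr_ge0// exprn_ge0// ltW.
(* Sum of the four instances of [main]: by [sumP] and [suma] the cross terms cancel, and the squares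
   of [c 1%N] and [c 2%N] enter with a favourable sign. *)
have key : eps * t ^+ 2 <= 2 * (S * B) * t ^+ 3.
  have suma' : eps * cabs (a + Complex t 0) ^+ 2 + eps * cabs (a + Complex 0 t) ^+ 2 +
    eps * cabs (a + Complex (- t) 0) ^+ 2 + eps * cabs (a + Complex 0 (- t)) ^+ 2 =
    4 * (eps * cabs a ^+ 2 + eps * t ^+ 2) by rewrite -!mulrDr suma; ring.
  lra.
(* Contradicts [teps], by which [eps] is at least [4 * (S * B) * t + t]. *)
have : eps <= 2 * (S * B) * t.
  have t20 : 0 < t ^+ 2 by rewrite exprn_gt0.
  rewrite -(ler_pM2r t20) (le_trans key)// le_eqVlt; apply/orP; left.
  by apply/eqP; ring.
have : 0 <= (S * B) * t by rewrite mulr_ge0// ltW.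
lra.
Qed.
End MaximumModulus.

(** * Cauchy's estimates and Taylor remainders *)

Section CauchyEstimates.
Variable R : realType.
Local Notation C := (Cplx R).
Implicit Types (g : C -> C) (a s : C) (c : nat -> C) (r M : R).

Lemma expandable_comb r g m (u w : 'I_m -> C) : (forall j, cabs (w j) = 1) ->
  expandable r g -> expandable r (fun s => \sum_(j < m) u j * g (w j * s)).
Proof.
move=> w1 hg a ar.
have /choice [c hc] : forall j : 'I_m, exists c, expands g (w j * a) c.
  by move=> j; apply: hg; rewrite cabsM w1 mul1r.
eexists; apply: expands_sum => j; apply: expandsZ; exact: expands_rot.
Qed.

(* Averaging [g] over the rotations by (m+1)-th roots of unity kills the
   coefficients below [m] and keeps the m-th one. *)
Lemma cauchy_estimate g r M c m : 0 < r -> expandable r g -> expands g 0 c ->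
  (forall s, cabs s = r -> cabs (g s) <= M) -> cabs (c m) * r ^+ m <= M.
Proof.
move=> r0 hg hc hM.
have [w hw] := exists_primitive_root R (ltn0Sn m).
have w1 := cabs_primitive_root hw.
have wX j : cabs (w ^+ j) = 1 by rewrite cabsX w1 expr1n.
have mn0 : (m.+1%:R : C) != 0 by rewrite -cabs_eq0 cabs_nat pnatr_eq0.
(* The weight [w ^+ j] makes the k-th coefficient a multiple of the sum of the [w ^+ (k.+1 * j)],
   which vanishes unless [m.+1] divides [k.+1]. *)
pose G s := \sum_(j < m.+1) (w ^+ j / m.+1%:R) * g (w ^+ j * s).
pose d k := \sum_(j < m.+1) (w ^+ j / m.+1%:R) * (c k * (w ^+ j) ^+ k).
have hG : expandable r G by apply: expandable_comb.
have hGd : expands G 0 d.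
  apply: expands_sum => j; apply: expandsZ; apply: expands_rot => //.
  by rewrite mulr0.
have dE k : d k = c k / m.+1%:R * \sum_(j < m.+1) w ^+ (k.+1 * j).
  rewrite mulr_sumr; apply: eq_bigr => j _.
  by rewrite mulnC exprM exprS; ring.
have dm : d m = c m.
  rewrite dE; under eq_bigr do rewrite exprM (prim_expr_order hw) expr1n.
  by rewrite sumr_const card_ord -[1 *+ _]/(_%:R) divfK.
have dlt k : (k < m)%N -> d k = 0.
  move=> km; rewrite dE (sum_primitive_root hw) ?mulr0//.
  by rewrite gtnNdvd// ltnS.
have GM s : cabs s = r -> cabs (G s) <= M.
  move=> sr; apply: (le_trans (cabs_sum _ _ _)).
  apply: (@le_trans _ _ (\sum_(j < m.+1) m.+1%:R^-1 * M)).
    apply: ler_sum => j _; rewrite cabsM cabsf wX cabs_nat mul1r.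
    by rewrite ler_wpM2l ?invr_ge0// hM// cabsM wX mul1r.
  by rewrite sumr_const card_ord -[leLHS]mulr_natl mulrA divff ?mul1r.
have [q [hq hqd Gq]] := expandable_factor m (ltW r0) hG hGd.
have rm0 : 0 < r ^+ m by rewrite exprn_gt0.
(* Now [G s = s ^+ m * q s] with [q 0 = c m], so that the maximum principle for [q] carries the
   bound from the circle to 0. *)
have : cabs (q 0) <= M / r ^+ m.
  apply: (maximum_modulus (ltW r0) hq) => [s sr|]; last by rewrite cabs0 ltW.
  rewrite ler_pdivlMr//; have := GM s sr; rewrite Gq big1 ?add0r => [|i _].
    by rewrite cabsM cabsX sr mulrC.
  by rewrite dlt ?mul0r.
by rewrite (expands_at hqd) addn0 dm ler_pdivlMr.
Qed.

(** The remainder is [s ^+ m * q s]. On the circle it is bounded by [M] for [g] plus [M] for each of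
    the [m] Taylor terms; the maximum principle for [q] extends this inside. *)
Lemma taylor_remainder g r M c m s : 0 < r -> expandable r g -> expands g 0 c ->
  (forall s, cabs s = r -> cabs (g s) <= M) -> cabs s <= r ->
  cabs (g s - \sum_(k < m) c k * s ^+ k) <= m.+1%:R * M * (cabs s / r) ^+ m.
Proof.
move=> r0 hg hc hM sr.
have [q [hq hqd gq]] := expandable_factor m (ltW r0) hg hc.
have rm0 : 0 < r ^+ m by rewrite exprn_gt0.
have : cabs (q s) <= m.+1%:R * M / r ^+ m.
  apply: (maximum_modulus (ltW r0) hq) sr => {}s sr.
  rewrite ler_pdivlMr//.
  have -> : cabs (q s) * r ^+ m = cabs (g s - \sum_(k < m) c k * s ^+ k).
    by rewrite gq addrAC subrr add0r cabsM cabsX sr mulrC.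
  apply: (le_trans (cabsB _ _)).
  rewrite -addn1 natrD mulrDl mul1r addrC lerD ?hM//.
  apply: (le_trans (cabs_sum _ _ _)).
  rewrite (_ : m%:R * M = \sum_(k < m) M); last by rewrite sumr_const card_ord mulr_natl.
  apply: ler_sum => k _; rewrite cabsM cabsX sr.
  exact: (cauchy_estimate k r0 hg hc hM).
rewrite gq addrAC subrr add0r cabsM cabsX => hqs.
rewrite expr_div_n mulrCA ler_wpM2l ?exprn_ge0 ?cabs_ge0//.
Qed.
End CauchyEstimates.

(** * Directional derivatives of analytic functions *)

Section UnorderedSums.
Variables (R : realType) (I : choiceType).
Local Notation C := (Cplx R).
Implicit Types (f g : I -> C) (s t w : C) (A D : {fset I}) (B : R).

Lemma has_sum_ext f g s : f =1 g -> has_sum f s -> has_sum g s.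
Proof. by move=> /funext ->. Qed.

Lemma has_sumD f g s t : has_sum f s -> has_sum g t ->
  has_sum (fun i => f i + g i) (s + t).
Proof.
move=> hf hg e e0; have e20 : 0 < e / 2 by rewrite divr_gt0.
have [A1 {}hf] := hf _ e20; have [A2 {}hg] := hg _ e20.
exists (A1 `|` A2)%fset => A; rewrite fsubUset => /andP[/hf {}hf /hg {}hg].
rewrite big_split /= opprD addrACA (splitr e).
by rewrite (le_lt_trans (cabsD _ _))// ltrD.
Qed.

Lemma has_sumZ f s w : has_sum f s -> has_sum (fun i => w * f i) (w * s).
Proof.
move=> hf e e0; have w10 : 0 < cabs w + 1 by rewrite ltr_wpDl ?cabs_ge0.
have [A0 {}hf] := hf _ (divr_gt0 e0 w10); exists A0 => A /hf {}hf.
rewrite -mulr_sumr -mulrBr cabsM; move: hf; rewrite ltr_pdivlMr// => hf.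
by apply: le_lt_trans hf; rewrite mulrC ler_wpM2l ?cabs_ge0// lerDl.
Qed.

Lemma has_sum0 : has_sum (fun _ : I => 0 : C) 0.
Proof. by move=> e e0; exists fset0 => A _; rewrite big1// subrr cabs0. Qed.

Lemma has_sum_finite (J : Type) (r : seq J) (f : J -> I -> C) (s : J -> C) :
  (forall j, has_sum (f j) (s j)) ->
  has_sum (fun i => \sum_(j <- r) f j i) (\sum_(j <- r) s j).
Proof.
move=> hf; elim: r => [|j r IH].
  by rewrite big_nil; apply: has_sum_ext has_sum0 => i; rewrite big_nil.
rewrite big_cons; apply: has_sum_ext (has_sumD (hf j) IH) => i.
by rewrite big_cons.
Qed.

Lemma has_sum_uniq f s t : has_sum f s -> has_sum f t -> s = t.
Proof.
move=> hs ht; apply/eqP; rewrite -subr_eq0 -cabs_eq0 eq_le cabs_ge0 andbT.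
apply/ler_addgt0Pr => e e0; rewrite add0r.
have e20 : 0 < e / 2 by rewrite divr_gt0.
have [A1 {}hs] := hs _ e20; have [A2 {}ht] := ht _ e20.
have {}hs := hs _ (fsubsetUl A1 A2); have {}ht := ht _ (fsubsetUr A1 A2).
rewrite -(subrKA (\sum_(i <- (A1 `|` A2)%fset) f i)) (splitr e) ltW//.
by rewrite (le_lt_trans (cabsD _ _))// ltrD// cabs_distC.
Qed.

Lemma has_sum_le f s B : has_sum f s ->
  (forall A, cabs (\sum_(i <- A) f i) <= B) -> cabs s <= B.
Proof.
move=> hs hB; apply/ler_addgt0Pr => e e0; have [A {}hs] := hs _ e0.
rewrite (le_trans (cabs_le_dist _ (\sum_(i <- A) f i)))// lerD//.
exact/ltW/hs/fsubset_refl.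
Qed.

(** Finite sums over sets disjoint from [A0] have modulus at most 2, since adding [A0] stays within
    1 of [s]. Splitting by sign bounds the absolute real parts by 2 + 2, and likewise the imaginary
    parts. *)
Lemma has_sum_abs_bounded f s : has_sum f s ->
  exists B, forall A, \sum_(i <- A) cabs (f i) <= B.
Proof.
move=> /(_ 1 ltr01) [A0 hs].
have small D : (D `&` A0)%fset = fset0 -> cabs (\sum_(i <- D) f i) <= 2.
  move=> DA; have := hs _ (fsubset_refl A0); have := hs _ (fsubsetUr D A0).
  have -> : \sum_(i <- (D `|` A0)%fset) f i = \sum_(i <- D) f i + \sum_(i <- A0) f i.
    rewrite (big_fsetID _ (mem D)) /=; congr (_ + _); apply: eq_fbigl => i.
      by rewrite !inE /= andb_idl// => ->.
    rewrite !inE /=; have := congr1 (fun X : {fset I} => i \in X) DA.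
    by rewrite !inE; case: (i \in D); case: (i \in A0).
  set x := \sum_(i <- D) _; set y := \sum_(i <- A0) _ => h1 h2.
  have -> : x = (s - y) - (s - (x + y)) by ring.
  by rewrite (le_trans (cabsB _ _))// (_ : 2 = 1 + 1)// lerD// ltW.
have half (u : I -> R) D : (D `&` A0)%fset = fset0 ->
    (forall A, `|\sum_(i <- A) u i| <= cabs (\sum_(i <- A) f i)) ->
    \sum_(i <- D) `|u i| <= 4.
  move=> DA hu.
  rewrite (big_fsetID _ (fun i => 0 <= u i)) /=.
  rewrite (_ : 4 = 2 + 2 :> R); last by rewrite -natrD.
  have sub (P : pred I) : ([fset i | i in D & P i] `&` A0)%fset = fset0.
    apply/eqP; rewrite -fsubset0 -DA; apply: fsetSI.
    by apply/fsubsetP => i; rewrite !inE => /andP[].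
  apply: lerD.
    apply: le_trans (small _ (sub (fun i => 0 <= u i))).
    apply: le_trans (hu _); rewrite ler_normr; apply/orP; left.
    rewrite le_eqVlt; apply/orP; left; apply/eqP.
    by apply: eq_big_seq => i; rewrite !inE => /andP[_ /ger0_norm].
  apply: le_trans (small _ (sub (fun i => ~~ (0 <= u i)))).
  apply: le_trans (hu _); rewrite ler_normr; apply/orP; right.
  rewrite -sumrN le_eqVlt; apply/orP; left; apply/eqP.
  apply: eq_big_seq => i; rewrite !inE => /andP[_].
  by rewrite -ltNge => /ltr0_norm.
have ReS A : complex.Re (\sum_(i <- A) f i) = \sum_(i <- A) complex.Re (f i).
  exact: (raddf_sum (@complex.Re R : Rcomplex R -> R)).
have ImS A : complex.Im (\sum_(i <- A) f i) = \sum_(i <- A) complex.Im (f i).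
  exact: (raddf_sum (@complex.Im R : Rcomplex R -> R)).
exists (\sum_(i <- A0) cabs (f i) + (4 + 4)) => A.
rewrite (big_fsetID _ (mem A0)) /=; apply: lerD.
  have -> : [fset i | i in A & i \in A0]%fset = (A `&` A0)%fset.
    by apply/fsetP => i; rewrite !inE.
  rewrite [leRHS](big_fsetID _ (mem A)) /=.
  have -> : [fset i | i in A0 & i \in A]%fset = (A `&` A0)%fset.
    by apply/fsetP => i; rewrite !inE andbC.
  by rewrite lerDl sumr_ge0// => i _; exact: cabs_ge0.
set D := [fset i | i in A & i \notin A0]%fset.
have DA : (D `&` A0)%fset = fset0.
  by apply/fsetP => i; rewrite !inE -andbA andNb andbF.
apply: (@le_trans _ _ (\sum_(i <- D) (`|complex.Re (f i)| + `|complex.Im (f i)|))).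
  by apply: ler_sum => i _; exact: cabs_le_ReIm.
rewrite big_split /= lerD//; apply: half => // A'.
  by rewrite -ReS Re_le_cabs.
by rewrite -ImS Im_le_cabs.
Qed.

(** The sum is the supremum of the finite partial sums, which increase with the index set. *)
Lemma has_sum_nonneg (u : I -> R) B : (forall i, 0 <= u i) ->
  (forall A, \sum_(i <- A) u i <= B) -> exists s, has_sum (fun i => ofR (u i)) s.
Proof.
move=> u0 hB; pose E := [set \sum_(i <- A) u i | A in [set: {fset I}]].
have supE : has_sup E.
  by split; [exists (\sum_(i <- fset0) u i), fset0|exists B => _ [A _ <-]].
exists (ofR (sup E)) => e e0; have [_ [A0 _ <-] hA0] := sup_adherent e0 supE.
exists A0 => A A0A.
have -> : \sum_(i <- A) ofR (u i) = ofR (\sum_(i <- A) u i).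
  exact/esym/(raddf_sum (real_complex R)).
have -> : ofR (sup E) - ofR (\sum_(i <- A) u i) = ofR (sup E - \sum_(i <- A) u i).
  exact/esym/(raddfB (real_complex R)).
rewrite cabs_ofR ger0_norm; last first.
  by rewrite subr_ge0 sup_upper_bound//; exists A.
rewrite ltrBlDr -ltrBlDl (lt_le_trans hA0)//.
rewrite [leRHS](big_fsetID _ (mem A0)) /=.
have -> : [fset i | i in A & i \in A0]%fset = A0.
  by apply/fsetP => i; rewrite !inE andb_idl// => /(fsubsetP A0A).
by rewrite lerDl sumr_ge0.
Qed.

(** Real and imaginary parts are treated separately, each as the difference of the nonnegative
    families [|u| + u] and [|u|]. *)
Lemma has_sum_exists f B : (forall A, \sum_(i <- A) cabs (f i) <= B) ->
  exists s, has_sum f s.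
Proof.
move=> hB.
have part (u : I -> R) : (forall i, `|u i| <= cabs (f i)) ->
    exists s, has_sum (fun i => ofR (u i)) s.
  move=> hu.
  have [s1 hs1] : exists s, has_sum (fun i => ofR `|u i|) s.
    apply: (@has_sum_nonneg _ B) => // A.
    by apply: le_trans (hB A); exact: ler_sum.
  have [s2 hs2] : exists s, has_sum (fun i => ofR (`|u i| + u i)) s.
    apply: (@has_sum_nonneg _ (B + B)) => [i|A].
      by have := ler_norm (- u i); rewrite normrN; lra.
    rewrite big_split /= lerD//; apply: le_trans (hB A); apply: ler_sum => i _ //.
    exact: le_trans (ler_norm _) (hu i).
  exists (s2 + -1 * s1); apply: has_sum_ext (has_sumD hs2 (has_sumZ (-1) hs1)) => i.
  by rewrite ofRD; ring.
have [s1 hs1] := part (fun i => complex.Re (f i)) (fun i => Re_le_cabs (f i)).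
have [s2 hs2] := part (fun i => complex.Im (f i)) (fun i => Im_le_cabs (f i)).
exists (s1 + 'i%C * s2); apply: has_sum_ext (has_sumD hs1 (has_sumZ 'i%C hs2)) => i.
exact/esym/complexE.
Qed.
End UnorderedSums.

(** * Polynomials, their expansions and formal derivatives *)

Section PolynomialExpansions.
Variable R : realType.
Local Notation C := (Cplx R).

Lemma horner_expands (p : {poly C}) (a : C) :
  expands (fun s => p.[s]) a (fun k => (p \Po ('X + a%:P))`_k).
Proof.
move=> m; set q := p \Po ('X + a%:P).
(* For [cabs h < 1] each coefficient from [m] on contributes at most its modulus times
   [cabs h ^+ m]; indices beyond the degree give 0. *)
exists (\sum_(k < size q) cabs q`_(m + k)), 1; split => // [|h h1].
  by rewrite sumr_ge0// => i _; exact: cabs_ge0.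
have -> : p.[a + h] = \sum_(k < m + size q) q`_k * h ^+ k.
  rewrite -(@horner_coef_wide _ (m + size q) q) ?leq_addl//.
  by rewrite /q horner_comp !hornerE addrC.
rewrite big_split_ord /= addrAC subrr add0r (le_trans (cabs_sum _ _ _))// mulr_suml.
apply: ler_sum => k _; rewrite cabsM cabsX exprD ler_wpM2l ?cabs_ge0//.
by rewrite ler_piMr ?exprn_ge0 ?cabs_ge0// exprn_ile1 ?cabs_ge0// ltW.
Qed.

Lemma horner_expandable r (p : {poly C}) : expandable r (fun s => p.[s]).
Proof. by move=> a _; eexists; exact: horner_expands. Qed.

Lemma horner_expands0 (p : {poly C}) :
  expands (fun s => p.[s]) 0 (fun k => p`_k).
Proof. by have := @horner_expands p 0; rewrite addr0 comp_polyXr. Qed.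
End PolynomialExpansions.

(* A deep embedding of polynomials, so that directional derivatives can be taken
   formally and iterated. *)
Inductive pexp (K : Type) (n : nat) : Type :=
| PCst of K
| PVar of 'I_n
| PAdd of pexp K n & pexp K n
| PMul of pexp K n & pexp K n.
Arguments PVar {K n}.
Arguments PCst {K n}.

Section PolynomialExpressions.
Variables (R : realType) (n : nat).
Local Notation C := (Cplx R).
Local Notation vec := (CVec R n).
Local Notation pexp := (pexp C n).
Implicit Types (e : pexp) (z v b : vec).

Fixpoint pev e z : C := match e with
  | PCst c => c
  | PVar j => z 0 j
  | PAdd e1 e2 => pev e1 z + pev e2 z
  | PMul e1 e2 => pev e1 z * pev e2 z
  end.

Fixpoint pder v e : pexp := match e with
  | PCst c => PCst 0
  | PVar j => PCst (v 0 j)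
  | PAdd e1 e2 => PAdd (pder v e1) (pder v e2)
  | PMul e1 e2 => PAdd (PMul (pder v e1) e2) (PMul e1 (pder v e2))
  end.

(** Restriction to the line [z + h *: v], as a polynomial in [h]: there [pder v] is the formal
    derivative, and Cauchy's estimates apply to the coefficients. *)
Fixpoint pslice v z e : {poly C} := match e with
  | PCst c => c%:P
  | PVar j => (z 0 j)%:P + (v 0 j)%:P * 'X
  | PAdd e1 e2 => pslice v z e1 + pslice v z e2
  | PMul e1 e2 => pslice v z e1 * pslice v z e2
  end.

Lemma pslice_horner v z e (h : C) : (pslice v z e).[h] = pev e (z + h *: v).
Proof.
elim: e => [c|j|e1 IH1 e2 IH2|e1 IH1 e2 IH2] /=; rewrite !hornerE ?IH1 ?IH2//.
by rewrite !mxE mulrC.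
Qed.

Lemma pslice_pder v z e : pslice v z (pder v e) = (pslice v z e)^`().
Proof.
elim: e => [c|j|e1 IH1 e2 IH2|e1 IH1 e2 IH2] /=.
- by rewrite derivC.
- by rewrite derivD derivM !derivC derivX mulr1 mul0r !add0r.
- by rewrite derivD IH1 IH2.
- by rewrite derivM IH1 IH2.
Qed.

Lemma pev_iter_pder v z e k :
  pev (iter k (pder v) e) z = k`!%:R * (pslice v z e)`_k.
Proof.
have -> : pev (iter k (pder v) e) z = (pslice v z (iter k (pder v) e)).[0].
  by rewrite pslice_horner scale0r addr0.
have -> : pslice v z (iter k (pder v) e) = (pslice v z e)^`(k).
  by elim: k => [//|k IH]; rewrite iterS pslice_pder IH derivnS.
by rewrite horner_coef0 coef_derivn addn0 ffactnn mulr_natl.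
Qed.

Lemma pev_pder v z e : pev (pder v e) z = (pslice v z e)`_1.
Proof. by have := pev_iter_pder v z e 1; rewrite (_ : 1`! = 1%N)// mul1r. Qed.

(** Brings the formal derivative into the shape of [dirD], a combination of partial derivatives. *)
Lemma pev_pder_sum b z e :
  pev (pder b e) z = \sum_(j < n) pev (pder (delta_mx 0 j) e) z * b 0 j.
Proof.
elim: e => [c|j|e1 IH1 e2 IH2|e1 IH1 e2 IH2] /=.
- by rewrite big1// => j _; rewrite mul0r.
- rewrite (bigD1 j)//= mxE !eqxx mul1r big1 ?addr0// => i ij.
  by rewrite mxE eq_sym (negbTE ij) andbF mul0r.
- by rewrite IH1 IH2 -big_split; apply: eq_bigr => j _; rewrite mulrDl.
- rewrite IH1 IH2 mulr_suml mulr_sumr -big_split; apply: eq_bigr => j _ /=.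
  ring.
Qed.

Fixpoint ppow e k : pexp := if k is k.+1 then PMul e (ppow e k) else PCst 1.

Lemma pev_ppow e k z : pev (ppow e k) z = pev e z ^+ k.
Proof. by elim: k => [|k IH] /=; rewrite ?expr0// exprS IH. Qed.

Definition pprod (J : Type) (r : seq J) (f : J -> pexp) : pexp :=
  foldr (fun j => PMul (f j)) (PCst 1) r.

Lemma pev_pprod (J : Type) (r : seq J) (f : J -> pexp) z :
  pev (pprod r f) z = \prod_(j <- r) pev (f j) z.
Proof. by elim: r => [|j r IH] /=; rewrite ?big_nil// big_cons IH. Qed.
End PolynomialExpressions.

Section DominatedSums.
Variables (R : realType) (n : nat).
Local Notation C := (Cplx R).
Local Notation vec := (CVec R n).
Local Notation pexp := (pexp C n).
Implicit Types (a z v b : vec) (F : vec -> C) (rho : R).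

Definition polydisc a rho z := forall j, cabs (z 0 j - a 0 j) <= rho.

Lemma polydisc_center a rho : 0 <= rho -> polydisc a rho a.
Proof. by move=> rho0 j; rewrite subrr cabs0. Qed.

(* Used in place of the power series itself: under differentiation the summands
   stay polynomials with the same index set, and only the polydisc shrinks. *)
Definition dominated_sum (I : choiceType) (e : I -> pexp) a rho F :=
  exists (M : I -> R) (B : R),
  [/\ forall A : {fset I}, \sum_(i <- A) M i <= B,
      forall i z, polydisc a rho z -> cabs (pev (e i) z) <= M i &
      forall z, polydisc a rho z -> has_sum (fun i => pev (e i) z) (F z)].

Variable I : choiceType.
Implicit Type e : I -> pexp.

Lemma polydisc_slice a rho rho' z v V h : 0 < V -> (forall j, cabs (v 0 j) <= V) ->
  polydisc a rho' z -> cabs h <= (rho - rho') / V -> polydisc a rho (z + h *: v).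
Proof.
move=> V0 hV hz; rewrite ler_pdivlMr// => hh j; rewrite !mxE.
have -> : z 0 j + h * v 0 j - a 0 j = (z 0 j - a 0 j) + h * v 0 j by ring.
rewrite (le_trans (cabsD _ _))// cabsM.
have := hz j; have := ler_wpM2l (cabs_ge0 h) (hV j); lra.
Qed.

(** Cauchy's estimates bound the k-th coefficients of the summands by [M i / r ^+ k], hence they are
    summable. The Taylor remainders of the summands are bounded by a fixed multiple of [M i] and add
    up to that of [F]. *)
Lemma dominated_slice e a rho rho' F z v V : dominated_sum e a rho F ->
  0 < V -> (forall j, cabs (v 0 j) <= V) -> rho' < rho -> polydisc a rho' z ->
  exists c : nat -> C,
    (forall k, has_sum (fun i => (pslice v z (e i))`_k) (c k)) /\
    expands (fun h => F (z + h *: v)) 0 c.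
Proof.
move=> [M [B [hB hM hF]]] V0 hV rr hz; pose r := (rho - rho') / V.
have r0 : 0 < r by rewrite divr_gt0// subr_gt0.
have disc h : cabs h <= r -> polydisc a rho (z + h *: v).
  exact: polydisc_slice.
have circ i h : cabs h = r -> cabs (pslice v z (e i)).[h] <= M i.
  by move=> hr; rewrite pslice_horner hM//; apply: disc; rewrite hr.
have coef i k : cabs (pslice v z (e i))`_k <= M i / r ^+ k.
  rewrite ler_pdivlMr ?exprn_gt0//.
  exact: (cauchy_estimate k r0 (@horner_expandable _ r _) (horner_expands0 _) (circ i)).
have /choice [c hc] : forall k, exists s, has_sum (fun i => (pslice v z (e i))`_k) s.
  move=> k; apply: (@has_sum_exists _ _ _ (B / r ^+ k)) => A.
  apply: (@le_trans _ _ (\sum_(i <- A) M i / r ^+ k)); first exact: ler_sum.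
  by rewrite -mulr_suml ler_wpM2r// invr_ge0 exprn_ge0// ltW.
exists c; split => // m; exists (m.+1%:R * B / r ^+ m), r; split => // [|h hr].
  rewrite divr_ge0 ?exprn_ge0 ?(ltW r0)// mulr_ge0//.
  by apply: le_trans (hB fset0); rewrite big_seq_fset0.
have hr' := ltW hr.
(* The remainder of [F] as the unordered sum of the remainders of the summands. *)
have hs : has_sum (fun i => (pslice v z (e i)).[h] +
    \sum_(k < m) - h ^+ k * (pslice v z (e i))`_k)
    (F (z + h *: v) + \sum_(k < m) - h ^+ k * c k).
  apply: has_sumD.
    by apply: has_sum_ext (hF _ (disc h hr')) => i; rewrite pslice_horner.
  by apply: has_sum_finite => k; apply: has_sumZ.
have E (p : {poly C}) (x : C) : x + \sum_(k < m) - h ^+ k * p`_k =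
    x - \sum_(k < m) p`_k * h ^+ k.
  by rewrite -sumrN; congr (_ + _); apply: eq_bigr => k _; rewrite mulNr mulrC.
have -> : F (z + (0 + h) *: v) - \sum_(k < m) c k * h ^+ k =
    F (z + h *: v) + \sum_(k < m) - h ^+ k * c k.
  by rewrite add0r -sumrN; congr (_ + _); apply: eq_bigr => k _; rewrite mulNr mulrC.
apply: has_sum_le hs _ => A; apply: (le_trans (cabs_sum _ _ _)).
apply: (@le_trans _ _ (\sum_(i <- A) m.+1%:R * (cabs h / r) ^+ m * M i)).
  apply: ler_sum => i _; rewrite E mulrAC.
  exact: (taylor_remainder m r0 (@horner_expandable _ r _) (horner_expands0 _) (circ i)).
rewrite -mulr_sumr expr_div_n.
rewrite (_ : _ * B / _ * _ = m.+1%:R * (cabs h ^+ m / r ^+ m) * B); last by ring.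
by rewrite ler_wpM2l// mulr_ge0// divr_ge0// exprn_ge0 ?cabs_ge0// ltW.
Qed.
End DominatedSums.

(** * Taylor expansions of analytic functions along a direction *)

Section AnalyticSlices.
Variables (R : realType) (n : nat).
Local Notation C := (Cplx R).
Local Notation vec := (CVec R n).
Implicit Types (a z v b : vec) (F : vec -> C).

(** In the order of [R[i]] a positive element has zero imaginary part, so tolerances and radii taken
    in [R[i]] come from [R]. *)
Lemma posC (e : R[i]) : 0 < e -> exists2 r : R, 0 < r & e = ofR r.
Proof.
case: e => x y; rewrite ltcE /= => /andP[/eqP -> x0]; by exists x.
Qed.

(** By the expansion of order 2, the difference quotient is within [B * cabs h] of [c 1%N]. *)
Lemma derive_expands F z v c :
  expands (fun h => F (z + h *: v)) 0 c -> 'D_v F z = c 1%N.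
Proof.
move=> hF; have Fz := expands_at hF; rewrite scale0r addr0 in Fz.
have [B [d [B0 d0 hB]]] := hF 2%N.
apply: cvg_lim; first exact: norm_hausdorff.
apply/cvgrPdist_le => e /posC[e' e0 ->] /=.
have B10 : 0 < B + 1 by rewrite ltr_wpDl.
apply/nbhs_ballP; exists (ofR (Num.min d (e' / (B + 1)))).
  by rewrite /= ltcR lt_min d0 divr_gt0.
move=> h; rewrite /ball /= sub0r normrN normE ltcR lt_min => /andP[hd he] hn0.
have ha : 0 < cabs h by rewrite cabs_gt0.
have := hB h hd; rewrite !big_ord_recr big_ord0 /= add0r expr0 mulr1 expr1 add0r => hBh.
rewrite normE lecR.
have -> : c 1%N - h^-1 *: (F (h *: v + z) - F z) =
    - (F (z + h *: v) - (c 0%N + c 1%N * h)) / h.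
  by rewrite Fz [h *: v + z]addrC /GRing.scale /=; field.
rewrite cabsf cabsN ler_pdivrMr// (le_trans hBh)// expr2 mulrA ler_wpM2r ?cabs_ge0//.
move: he; rewrite ltr_pdivlMr// => he; apply: le_trans (ltW he).
by rewrite mulrC ler_wpM2l ?cabs_ge0// lerDl.
Qed.

Lemma near_polydisc a (P : vec -> Prop) : (\forall z \near a, P z) ->
  exists2 rho, 0 < rho & forall z, polydisc a rho z -> P z.
Proof.
move=> /nbhs_ballP[e /= /posC[r r0 ->] hP]; exists (r / 2); first by rewrite divr_gt0.
move=> z hz; apply: hP; split=> [|i j]; first by rewrite ltcR.
rewrite ord1 /ball /= normE ltcR cabs_distC.
by rewrite (le_lt_trans (hz j))// ltr_pdivrMr// ltr_pMr// ltr1n.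
Qed.

(** Termwise differentiation: [dominated_slice] in each coordinate direction identifies the partial
    derivatives, and Cauchy's estimates over the gap [rho - rho'] give the new majorant. *)
Lemma dominated_dirD (I : choiceType) (e : I -> pexp C n) a rho rho' F b :
  dominated_sum e a rho F -> 0 < rho' -> rho' < rho ->
  dominated_sum (fun i => pder b (e i)) a rho' (dirD b F).
Proof.
move=> hF rho'0 rr; have d1 j k : cabs ((delta_mx 0 j : vec) 0 k) <= 1.
  by rewrite mxE cabs_nat lern1 leq_b1.
have [M [B [hB hM hs]]] := hF.
pose r := (rho - rho') / 1.
have r0 : 0 < r by rewrite /r divr1 subr_gt0.
have M0 i : 0 <= M i.
  apply: le_trans (hM i a _); rewrite ?cabs_ge0//.
  by apply: polydisc_center; rewrite ltW// (lt_trans rho'0).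
have coef i z j : polydisc a rho' z ->
    cabs (pev (pder (delta_mx 0 j) (e i)) z) <= M i / r.
  move=> hz; rewrite pev_pder ler_pdivlMr//.
  apply: (cauchy_estimate 1 r0 (@horner_expandable _ r _) (horner_expands0 _)) => h hr.
  rewrite pslice_horner hM//; apply: (polydisc_slice ltr01 (d1 j) hz).
  by rewrite hr.
exists (fun i => \sum_(j < n) M i / r * cabs (b 0 j)).
exists (\sum_(j < n) B / r * cabs (b 0 j)); split => [A|i z hz|z hz].
- rewrite exchange_big /=; apply: ler_sum => j _.
  rewrite -!mulr_suml; apply: ler_wpM2r; first exact: cabs_ge0.
  by rewrite ler_wpM2r ?invr_ge0 ?(ltW r0).
- rewrite pev_pder_sum (le_trans (cabs_sum _ _ _))//; apply: ler_sum => j _.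
  by rewrite cabsM ler_wpM2r ?cabs_ge0 ?coef.
- apply: (@has_sum_ext _ _ (fun i => \sum_(j < n)
      b 0 j * pev (pder (delta_mx 0 j) (e i)) z)) => [i|].
    by rewrite pev_pder_sum; apply: eq_bigr => j _; rewrite mulrC.
  rewrite /dirD; under eq_bigr do rewrite mulrC.
  apply: has_sum_finite => j; apply: has_sumZ.
  have [c [hc /derive_expands cD]] := dominated_slice hF ltr01 (d1 j) rr hz.
  rewrite /partial cD.
  by apply: has_sum_ext (hc 1%N) => i; rewrite pev_pder.
Qed.

Lemma dominated_dirDn (I : choiceType) (e : I -> pexp C n) a rho F b k :
  0 < rho -> dominated_sum e a rho F -> exists2 rho', 0 < rho' &
  dominated_sum (fun i => iter k (pder b) (e i)) a rho' (dirDn b k F).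
Proof.
move=> rho0 hF; elim: k => [|k [rho' rho'0 IH]]; first by exists rho.
exists (rho' / 2); first by rewrite divr_gt0.
apply: (dominated_dirD b IH); first by rewrite divr_gt0.
by rewrite ltr_pdivrMr// ltr_pMr// ltr1n.
Qed.

(** At the point whose coordinates are [a 0 j + rho], each monomial takes its largest modulus on the
    polydisc; absolute summability at that one point yields the majorant. *)
Lemma analytic_dominated (D : set vec) F a : analytic_in D F -> D a ->
  exists (I : choiceType) (e : I -> pexp C n), exists2 rho, 0 < rho &
    dominated_sum e a rho F.
Proof.
move=> hF /hF[c /near_polydisc[rho rho0 hc]].
pose e (al : {ffun 'I_n -> nat}) : pexp C n := PMul (PCst (c al))
  (pprod (index_enum 'I_n) (fun j => ppow (PAdd (PVar j) (PCst (- a 0 j))) (al j))).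
have eE al z : pev (e al) z = c al * \prod_(j < n) (z 0 j - a 0 j) ^+ al j.
  rewrite /= pev_pprod; congr (_ * _); apply: eq_bigr => j _.
  by rewrite pev_ppow.
exists {ffun 'I_n -> nat}, e, rho => //.
pose M al := cabs (c al) * \prod_(j < n) rho ^+ al j.
have hz0 : polydisc a rho (\row_j (a 0 j + ofR rho)).
  by move=> j; rewrite !mxE addrAC subrr add0r cabs_ofR gtr0_norm.
have [B hB] := has_sum_abs_bounded (hc _ hz0).
exists M, B; split => [A|i z hz|z /hc].
- apply: le_trans (hB A).
  apply: ler_sum => al _; rewrite cabsM ler_wpM2l ?cabs_ge0// le_eqVlt.
  apply/orP; left; apply/eqP.
  rewrite (big_morph (@cabs R) (@cabsM R) (@cabs1 R)); apply: eq_bigr => j _.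
  by rewrite !mxE addrAC subrr add0r cabsX cabs_ofR gtr0_norm.
- rewrite eE cabsM ler_wpM2l ?cabs_ge0//.
  rewrite (big_morph (@cabs R) (@cabsM R) (@cabs1 R)); apply: ler_prod => j _.
  by rewrite cabsX exprn_ge0 ?cabs_ge0//= lerXn2r ?nnegrE ?cabs_ge0 ?(ltW rho0).
- by apply: has_sum_ext => al; rewrite eE.
Qed.

(** The k-th coefficient of the slice and the k-th derivative along [b] are both computed termwise;
    the summands differ by the factor k factorial, and unordered sums are unique. *)
Lemma analytic_slice_expands (D : set vec) F b a : analytic_in D F -> D a ->
  expands (fun h => F (a + h *: b)) 0 (fun k => dirDn b k F a / k`!%:R).
Proof.
move=> hF Da; have [I [e [rho rho0 he]]] := analytic_dominated hF Da.
pose V := 1 + \sum_(j < n) cabs (b 0 j).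
have V0 : 0 < V by rewrite ltr_wpDr// sumr_ge0// => j _; exact: cabs_ge0.
have bV j : cabs (b 0 j) <= V.
  rewrite /V (bigD1 j)//= addrCA lerDl addr_ge0 ?sumr_ge0// => i _.
  exact: cabs_ge0.
have [c [hc hx]] := dominated_slice he V0 bV rho0 (polydisc_center a (lexx 0)).
apply: expands_ext hx => // k.
have [rho' rho'0 [M [B [_ _ hs]]]] := dominated_dirDn b k rho0 he.
have h1 := hs a (polydisc_center a (ltW rho'0)).
have h2 : has_sum (fun i => pev (iter k (pder b) (e i)) a) (k`!%:R * c k).
  apply: has_sum_ext (has_sumZ k`!%:R (hc k)) => i.
  by rewrite pev_iter_pder.
by rewrite (has_sum_uniq h1 h2) mulrC mulKf.
Qed.
End AnalyticSlices.

(** * Bounded index and growth on circles *)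

Section EuclideanNorm.
Variables (R : realType) (n : nat).
Local Notation C := (Cplx R).
Local Notation vec := (CVec R n).
Implicit Types (z w b : vec) (h : C).

(** For positive bounds, expand the nonnegative sum of the squares of [Y * x i - X * y i] and divide
    by [X * Y]. *)
Lemma cauchy_schwarz_nonneg (I : Type) (r : seq I) (x y : I -> R) (X Y : R) :
  (forall i, 0 <= x i) -> (forall i, 0 <= y i) -> 0 <= X -> 0 <= Y ->
  \sum_(i <- r) x i ^+ 2 <= X ^+ 2 -> \sum_(i <- r) y i ^+ 2 <= Y ^+ 2 ->
  \sum_(i <- r) x i * y i <= X * Y.
Proof.
move=> x0 y0 X0 Y0 hX hY; apply/ler_addgt0Pr => e e0.
(* Perturbing X and Y avoids the degenerate case X * Y = 0. *)
have key (X' Y' : R) : 0 < X' -> 0 < Y' -> X <= X' -> Y <= Y' ->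
    \sum_(i <- r) x i * y i <= X' * Y'.
  move=> X'0 Y'0 XX YY.
  have hX' : \sum_(i <- r) x i ^+ 2 <= X' ^+ 2.
    by rewrite (le_trans hX)// lerXn2r ?nnegrE// ltW.
  have hY' : \sum_(i <- r) y i ^+ 2 <= Y' ^+ 2.
    by rewrite (le_trans hY)// lerXn2r ?nnegrE// ltW.
  have : 0 <= \sum_(i <- r) (Y' * x i - X' * y i) ^+ 2.
    by apply: sumr_ge0 => i _; exact: sqr_ge0.
  have -> : \sum_(i <- r) (Y' * x i - X' * y i) ^+ 2 =
      Y' ^+ 2 * (\sum_(i <- r) x i ^+ 2) - 2 * (X' * Y') * (\sum_(i <- r) x i * y i)
      + X' ^+ 2 * (\sum_(i <- r) y i ^+ 2).
    rewrite !mulr_sumr -sumrB -big_split /=; apply: eq_bigr => i _; ring.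
  have := ler_wpM2l (sqr_ge0 Y') hX'; have := ler_wpM2l (sqr_ge0 X') hY' => h1 h2 h3.
  rewrite -(ler_pM2l (mulr_gt0 X'0 Y'0)).
  have -> : X' * Y' * (X' * Y') = X' ^+ 2 * Y' ^+ 2 by ring.
  by have := mulrC (X' ^+ 2) (Y' ^+ 2); lra.
(* As [d <= 1], the product [(X + d) * (Y + d)] exceeds [X * Y] by at most [d * (X + Y + 1)]. *)
pose d := Num.min 1 (e / (X + Y + 1)).
have XY0 : 0 < X + Y + 1 by rewrite ltr_wpDl// addr_ge0.
have d0 : 0 < d by rewrite lt_min ltr01 divr_gt0.
have d1 : d <= 1 by rewrite ge_min lexx.
have de : d * (X + Y + 1) <= e by rewrite -ler_pdivlMr// ge_min lexx orbT.
have := key (X + d) (Y + d); rewrite !ltr_wpDl// !lerDl (ltW d0) => /(_ _ _ _ _) h.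
have {}h : \sum_(i <- r) x i * y i <= (X + d) * (Y + d) by exact: h.
have dd : d * d <= d by rewrite ler_piMr// ltW.
lra.
Qed.

Lemma enorm_ge0 z : 0 <= enorm z.
Proof. exact: sqrtr_ge0. Qed.

Lemma sqr_enorm z : enorm z ^+ 2 = \sum_(j < n) cabs (z 0 j) ^+ 2.
Proof. by rewrite sqr_sqrtr// sumr_ge0// => j _; exact: sqr_ge0. Qed.

Lemma enormD z w : enorm (z + w) <= enorm z + enorm w.
Proof.
rewrite -ler_sqr ?nnegrE ?addr_ge0 ?enorm_ge0// sqr_enorm.
apply: (@le_trans _ _ (\sum_(j < n) (cabs (z 0 j) + cabs (w 0 j)) ^+ 2)).
  apply: ler_sum => j _; rewrite mxE lerXn2r ?nnegrE ?addr_ge0 ?cabs_ge0//.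
  exact: cabsD.
have -> : \sum_(j < n) (cabs (z 0 j) + cabs (w 0 j)) ^+ 2 =
    enorm z ^+ 2 + 2 * (\sum_(j < n) cabs (z 0 j) * cabs (w 0 j)) + enorm w ^+ 2.
  rewrite !sqr_enorm mulr_sumr -!big_split /=; apply: eq_bigr => j _; ring.
have := @cauchy_schwarz_nonneg _ (index_enum 'I_n) (fun j => cabs (z 0 j))
  (fun j => cabs (w 0 j)) (enorm z) (enorm w) (fun=> cabs_ge0 _) (fun=> cabs_ge0 _)
  (enorm_ge0 z) (enorm_ge0 w).
rewrite !sqr_enorm => /(_ (lexx _) (lexx _)); rewrite -!sqr_enorm.
have -> : (enorm z + enorm w) ^+ 2 =
  enorm z ^+ 2 + 2 * (enorm z * enorm w) + enorm w ^+ 2 by ring.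
lra.
Qed.

Lemma enormZ h b : enorm (h *: b) = cabs h * enorm b.
Proof.
rewrite /enorm; under eq_bigr do rewrite mxE cabsM exprMn.
by rewrite -mulr_sumr sqrtrM ?sqr_ge0// sqrtr_sqr ger0_norm ?cabs_ge0.
Qed.
End EuclideanNorm.

Section RealEstimates.
Variable R : realType.
Implicit Types (q K : R).

(** Bernoulli's inequality, squared at [N = k + k], gives a quadratic lower bound in [k]. *)
Lemma exponential_beats_linear q K : 1 < q ->
  exists N : nat, N.+1%:R * K <= q ^+ N.
Proof.
move=> q1; pose d := q - 1; have d0 : 0 < d by rewrite subr_gt0.
have bern k : k%:R * d <= q ^+ k.
  elim: k => [|k IH]; first by rewrite mul0r.
  have qk : 1 <= q ^+ k by rewrite exprn_ege1// ltW.
  have : d * 1 <= d * q ^+ k by rewrite ler_pM2l.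
  have -> : q ^+ k.+1 = q ^+ k + d * q ^+ k by rewrite exprS /d; ring.
  have -> : k.+1%:R * d = k%:R * d + d by rewrite -[k.+1%:R]natr1; ring.
  lra.
(* The 3 comes from [2 k + 1 <= 3 k] for [k >= 1]. *)
pose B := 3 * `|K| / d ^+ 2; have B0 : 0 <= B.
  by apply: divr_ge0; rewrite ?sqr_ge0// mulr_ge0.
have [k k_gt0 Bk] : exists2 k : nat, (0 < k)%N & B <= k%:R.
  by exists (Num.truncn B).+1; rewrite // ltW// truncnS_gt.
exists (k + k)%N; rewrite exprD.
have kd0 : 0 <= k%:R * d by rewrite mulr_ge0// ltW.
apply: (@le_trans _ _ ((k%:R * d) * (k%:R * d))); last by rewrite ler_pM.
have k1 : 1 <= k%:R :> R by rewrite ler1n.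
apply: (@le_trans _ _ (3 * k%:R * `|K|)).
  apply: (@le_trans _ _ ((k + k).+1%:R * `|K|)).
    by rewrite ler_wpM2l// ler_norm.
  by rewrite ler_wpM2r// -[(k + k).+1%:R]natr1 natrD; lra.
have : 3 * `|K| <= k%:R * d ^+ 2 by rewrite -ler_pdivrMr ?exprn_gt0.
have k0 : 0 <= k%:R :> R by [].
move=> /(ler_wpM2l k0); rewrite expr2.
lra.
Qed.
End RealEstimates.

(** * The two implications, slice by slice *)

Section DirectionalIndex.
Variables (R : realType) (n : nat) (beta : R) (b : CVec R n).
Variables (L : CVec R n -> R) (F : CVec R n -> Cplx R).
Hypotheses (beta_gt1 : 1 < beta) (LQ : Qclass b beta L).
Hypothesis F_analytic : analytic_in (unit_ball R n) F.
Local Notation C := (Cplx R).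
Local Notation ball1 := (unit_ball R n).
Implicit Types (w z : CVec R n) (h : C).

Let beta_gt0 : 0 < beta. Proof. exact: lt_trans beta_gt1. Qed.

Lemma L_gt0 w : ball1 w -> 0 < L w.
Proof. by case: LQ => _ h _ _; exact: h. Qed.

(** The lower bound on [L] in [Qclass] gives [cabs h * enorm b < 1 - enorm w]. *)
Lemma unit_ball_shift w h : ball1 w -> cabs h <= beta / L w -> ball1 (w + h *: b).
Proof.
move=> hw hh; have Lw := L_gt0 hw; have [_ _ /(_ w hw) hL _] := LQ.
have w1 : 0 < 1 - enorm w by rewrite subr_gt0.
rewrite /unit_ball /= (le_lt_trans (enormD _ _))// -ltrBrDl enormZ.
move: hL; rewrite ltr_pdivrMr// => hL.
apply: (@le_lt_trans _ _ (beta / L w * enorm b)).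
  by rewrite ler_wpM2r ?enorm_ge0.
by rewrite mulrAC ltr_pdivrMr// mulrC [_ * L w]mulrC mulrC in hL *.
Qed.

(** The values of [lambda1] and [lambda2] at [beta], read with base point [w] and [t0 = 0];
    positivity and finiteness make both of them real. *)
Lemma L_ratio_bounds : exists l1 l2, 0 < l1 /\
  forall w h, ball1 w -> cabs h <= beta / L w ->
    l1 * L w <= L (w + h *: b) <= l2 * L w.
Proof.
have [_ _ _ /(_ beta)] := LQ; rewrite lexx (ltW beta_gt0) => /(_ isT)[].
have mem w h : ball1 w -> cabs h <= beta / L w ->
    ratio_set b L beta (L (w + h *: b) / L w)%:E.
  move=> hw hh; exists w, 0, h.
  by rewrite /slice /= scale0r addr0 subr0.
have inf_le w h : ball1 w -> cabs h <= beta / L w ->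
    (lambda1 b L beta <= (L (w + h *: b) / L w)%:E)%E.
  by move=> hw hh; apply: ereal_inf_lbound; exact: mem.
have le_sup w h : ball1 w -> cabs h <= beta / L w ->
    ((L (w + h *: b) / L w)%:E <= lambda2 b L beta)%E.
  by move=> hw hh; apply: ereal_sup_ubound; exact: mem.
case: (lambda1 b L beta) (lambda2 b L beta) inf_le le_sup => [l1| |] [l2| |]//=.
move=> inf_le le_sup l10 _ _; rewrite lte_fin in l10.
exists l1, l2; split => // w h hw hh; have Lw := L_gt0 hw.
have := inf_le w h hw hh; have := le_sup w h hw hh; rewrite !lee_fin.
by rewrite ler_pdivrMr// ler_pdivlMr// => -> ->.
Qed.

Definition taylor_coef w k : C := dirDn b k F w / k`!%:R.

Lemma slice_expands w : ball1 w -> expands (fun h => F (w + h *: b)) 0 (taylor_coef w).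
Proof. exact: analytic_slice_expands F_analytic. Qed.

Lemma slice_expandable w r :
  (forall h, cabs h <= r -> ball1 (w + h *: b)) ->
  expandable r (fun h => F (w + h *: b)).
Proof.
move=> hr a /hr /slice_expands ha; eexists => m.
have [B [d [B0 d0 hB]]] := ha m; exists B, d; split => // h /hB.
by rewrite add0r scalerDl addrA; exact.
Qed.

Lemma slice_expandable_beta w r : ball1 w -> r <= beta / L w ->
  expandable r (fun h => F (w + h *: b)).
Proof.
move=> hw hr; apply: slice_expandable => h hh.
exact: unit_ball_shift hw (le_trans hh hr).
Qed.

(** The index terms are the moduli of the Taylor coefficients of the slice in the rescaled variable
    [L w * h]. *)
Lemma index_termE w k : ball1 w -> index_term b L F k w = cabs (taylor_coef w k) / L w ^+ k.
Proof.
by move=> hw; rewrite /index_term /taylor_coef cabsf cabs_nat invfM mulrC mulrA.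
Qed.

Lemma index_term_ge0 w k : ball1 w -> 0 <= index_term b L F k w.
Proof.
move=> hw; rewrite index_termE// divr_ge0 ?cabs_ge0// exprn_ge0//.
exact/ltW/L_gt0.
Qed.

Definition max_index m w := \big[Num.max/0]_(k < m.+1) index_term b L F k w.

Lemma le_max_index m w k : (k <= m)%N -> index_term b L F k w <= max_index m w.
Proof.
move=> km; have km' : (k < m.+1)%N by [].
exact: (@le_bigmax _ _ _ 0 (fun k : 'I_m.+1 => index_term b L F k w) (Ordinal km')).
Qed.

Lemma max_index_le m w M : 0 <= M ->
  (forall k, (k <= m)%N -> index_term b L F k w <= M) -> max_index m w <= M.
Proof. by move=> M0 hM; apply: bigmax_le => // k _; apply: hM; rewrite -ltnS. Qed.

Lemma max_index_ge0 m w : 0 <= max_index m w.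
Proof. exact: bigmax_ge_id. Qed.

Section Circles.
Variables (z0 : CVec R n) (t0 : C).
Hypothesis slice_t0 : slice b z0 t0.
Local Notation w := (z0 + t0 *: b).

Lemma circle_shift t : z0 + t *: b = w + (t - t0) *: b.
Proof. by rewrite -addrA -scalerDl [t0 + _]addrC subrK. Qed.

(** The supremum is a genuine upper bound because the slice is bounded on the closed disc. *)
Lemma le_circle_max rho h : rho <= beta / L w -> cabs h = rho ->
  cabs (F (w + h *: b)) <= circle_max b F z0 t0 rho.
Proof.
move=> hrho hh; apply: ub_le_sup; last first.
  exists (t0 + h); first by rewrite /= addrAC subrr add0r.
  by rewrite scalerDl addrA.
have rho0 : 0 <= rho by rewrite -hh cabs_ge0.
have [M hM] := expandable_bounded rho0 (slice_expandable_beta slice_t0 hrho).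
exists M => _ [t /= ht <-]; rewrite circle_shift.
by apply: hM; rewrite ht.
Qed.

Lemma circle_max_le rho M : 0 <= rho ->
  (forall h, cabs h = rho -> cabs (F (w + h *: b)) <= M) ->
  circle_max b F z0 t0 rho <= M.
Proof.
move=> rho0 hM; apply: ge_sup.
  exists (cabs (F (z0 + (t0 + ofR rho) *: b))), (t0 + ofR rho) => //=.
  by rewrite addrAC subrr add0r cabs_ofR ger0_norm.
by move=> _ [t /= ht <-]; rewrite circle_shift; exact: hM.
Qed.
End Circles.

(* Geometric series: the Taylor coefficients at [w] are at most [A L(w)^k], and
   [|h| L(w) <= 1/2]. *)
Lemma slice_bound w A h : ball1 w ->
  (forall m, index_term b L F m w <= A) -> cabs h <= 1 / (2 * L w) ->
  cabs (F (w + h *: b)) <= 2 * A.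
Proof.
move=> hw hA hh; have Lw := L_gt0 hw.
have A0 : 0 <= A := le_trans (index_term_ge0 0 hw) (hA 0%N).
have r0 : 0 < beta / L w by rewrite divr_gt0.
have hexp := slice_expandable_beta hw (lexx _).
have [M hM] := expandable_bounded (ltW r0) hexp.
have M0 : 0 <= M by apply: le_trans (hM 0 _); rewrite ?cabs_ge0 ?cabs0 ?ltW.
have hhb : cabs h <= beta / L w.
  rewrite (le_trans hh)// div1r invfM ler_wpM2r ?invr_ge0 ?(ltW Lw)//.
  by apply: le_trans (ltW beta_gt1); rewrite invf_le1// ler1n.
(* Since [beta > 1], the point [h] lies within half the radius [beta / L w]; this ratio governs the
   Taylor remainder. *)
have hrat : cabs h / (beta / L w) <= 2^-1.
  rewrite ler_pdivrMr// (le_trans hh)// div1r invfM ler_wpM2l// -[leLHS]mul1r.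
  by rewrite ler_wpM2r ?invr_ge0 ?(ltW Lw)// ltW.
have hratio0 : 0 <= cabs h / (beta / L w) by rewrite divr_ge0 ?cabs_ge0 ?(ltW r0).
apply/ler_addgt0Pr => e e0.
(* Makes the remainder [N.+1%:R * M / 2 ^+ N] at most [e]; the [N] Taylor terms contribute at most
   [2 * A]. *)
have [N hN] := exponential_beats_linear (M / e) (ltr1n R 2).
have hM' s : cabs s = beta / L w -> cabs (F (w + s *: b)) <= M.
  by move=> hs; apply: hM; rewrite hs.
have rem := taylor_remainder N r0 hexp (slice_expands hw) hM' hhb.
apply: (le_trans (cabs_le_dist _ (\sum_(k < N) taylor_coef w k * h ^+ k))).
apply: lerD.
  apply: (le_trans (cabs_sum _ _ _)).
  apply: (@le_trans _ _ (\sum_(k < N) A * 2^-1 ^+ k)).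
    apply: ler_sum => k _; rewrite cabsM cabsX.
    have := hA k; rewrite index_termE// ler_pdivrMr ?exprn_gt0// => hAk.
    apply: (@le_trans _ _ (A * L w ^+ k * cabs h ^+ k)).
      by rewrite ler_wpM2r ?exprn_ge0 ?cabs_ge0.
    rewrite -mulrA -exprMn ler_wpM2l// lerXn2r ?nnegrE ?mulr_ge0 ?cabs_ge0 ?(ltW Lw)//.
    by rewrite mulrC -ler_pdivlMr// (le_trans hh)// div1r invfM.
  rewrite -mulr_sumr mulrC ler_wpM2r//.
  have := subrX1 (2^-1 : R) N; have : 0 <= (2^-1 : R) ^+ N by rewrite exprn_ge0.
  set S := \sum_(_ < _) _; lra.
apply: (@le_trans _ _ (N.+1%:R * M * 2^-1 ^+ N)).
  apply: (le_trans rem).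
  by rewrite ler_wpM2l ?mulr_ge0// lerXn2r ?nnegrE.
rewrite exprVn ler_pdivrMr ?exprn_gt0//.
by move: hN; rewrite mulrA ler_pdivrMr// [2 ^+ N * e]mulrC.
Qed.

Lemma index_term0 w : index_term b L F 0 w = cabs (F w).
Proof. by rewrite /index_term fact0 expr0 mulr1 invr1 mul1r. Qed.

Section BoundedIndex.
Variable m0 : nat.
Hypothesis F_index : forall m z, ball1 z -> index_term b L F m z <= max_index m0 z.
Variables l1 l2 : R.
Hypothesis l1_gt0 : 0 < l1.
Hypothesis L_ratio : forall w h, ball1 w -> cabs h <= beta / L w ->
  l1 * L w <= L (w + h *: b) <= l2 * L w.

(** The 2 is that of [slice_bound]. The ratio [4 / l1] compares the radius [1 / (4 * L w)] with [L]
    at the new point; adding 1 makes the base at least 1, so that the power [m0] serves all smaller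
    orders. *)
Let K := 2 * (1 + 4 / l1) ^+ m0.

(** The disc of radius [rho] around the new point lies in the disc of radius [2 * rho] around [w],
    where [slice_bound] holds; Cauchy's estimates apply on the smaller disc. *)
Lemma max_index_step w h : ball1 w -> cabs h <= 1 / (4 * L w) ->
  max_index m0 (w + h *: b) <= K * max_index m0 w.
Proof.
move=> hw hh; have Lw := L_gt0 hw; set A := max_index m0 w.
have A0 : 0 <= A := max_index_ge0 m0 w.
pose rho := 1 / (4 * L w).
have rho0 : 0 < rho by rewrite divr_gt0 ?mulr_gt0.
have rho2 : rho + rho = 1 / (2 * L w).
  by rewrite /rho; field; rewrite gt_eqF.
have rhobeta : rho + rho <= beta / L w.
  rewrite rho2 div1r invfM ler_wpM2r ?invr_ge0 ?(ltW Lw)//.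
  by apply: le_trans (ltW beta_gt1); rewrite invf_le1// ler1n.
have sum_le s : cabs s <= rho -> cabs (h + s) <= rho + rho.
  by move=> hs; rewrite (le_trans (cabsD _ _))// lerD.
have hbeta : cabs h <= beta / L w by rewrite (le_trans hh)//; lra.
have hwh := unit_ball_shift hw hbeta.
have Lwh := L_gt0 hwh.
have hexp : expandable rho (fun s => F (w + h *: b + s *: b)).
  apply: slice_expandable => s hs; rewrite -addrA -scalerDl.
  exact: unit_ball_shift hw (le_trans (sum_le s hs) rhobeta).
have hF s : cabs s = rho -> cabs (F (w + h *: b + s *: b)) <= 2 * A.
  move=> hs; rewrite -addrA -scalerDl; apply: (slice_bound hw).
    by move=> m; exact: F_index.
  by rewrite -rho2 sum_le ?hs.
have l41 : 1 <= 1 + 4 / l1 by rewrite lerDl divr_ge0// ltW.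
apply: max_index_le => [|k km].
  by rewrite mulr_ge0// mulr_ge0// exprn_ge0// (le_trans _ l41).
have := cauchy_estimate k rho0 hexp (slice_expands hwh) hF.
rewrite index_termE// ler_pdivrMr ?exprn_gt0// -ler_pdivlMr ?exprn_gt0// => hk.
apply: (le_trans hk); rewrite ler_pdivrMr ?exprn_gt0// -mulrA -exprMn.
rewrite (_ : K * A * _ =
  2 * A * ((1 + 4 / l1) ^+ m0 * (L (w + h *: b) * rho) ^+ k)); last first.
  by rewrite /K; ring.
rewrite ler_peMr ?mulr_ge0//.
(* The base is at least 1, because [L (w + h *: b) >= l1 * L w] and [4 * L w * rho = 1]. *)
apply: (@le_trans _ _ ((1 + 4 / l1) ^+ k * (L (w + h *: b) * rho) ^+ k)).
  rewrite -exprMn exprn_ege1//.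
  have /andP[hL _] := L_ratio hw hbeta.
  apply: (@le_trans _ _ (4 / l1 * (l1 * L w * rho))).
    rewrite (_ : _ * _ = 1)// /rho; field; by rewrite !gt_eqF.
  have l1L : 0 <= l1 * L w * rho.
    by apply: mulr_ge0; [apply: mulr_ge0|]; exact: ltW.
  apply: ler_pM => //; [by rewrite divr_ge0// ltW|by rewrite lerDr|].
  by rewrite ler_wpM2r// ltW.
apply: ler_wpM2r; last exact: ler_weXn2l.
by apply: exprn_ge0; apply: mulr_ge0; exact: ltW.
Qed.

(* Uniformly many steps of [max_index_step] cross the disc of radius beta/L(w). *)
Lemma max_index_chain : exists2 Q, 1 <= Q & forall w h, ball1 w ->
  cabs h <= beta / L w -> max_index m0 (w + h *: b) <= Q * max_index m0 w.
Proof.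
have l41 : 1 <= 1 + 4 / l1 by rewrite lerDl divr_ge0// ltW.
have K1 : 1 <= K.
  have := exprn_ege1 m0 l41; rewrite /K; lra.
(* Each step has length at most [beta / (J * L w)], which must not exceed [1 / (4 * L)] at its
   starting point, where [L] is at most [l2 * L w]. *)
have [J J_gt0 hJ] : exists2 J : nat, (0 < J)%N & beta * (4 * l2) <= J%:R.
  by exists (Num.truncn (beta * (4 * l2))).+1; rewrite // ltW// truncnS_gt.
have J0 : 0 < J%:R :> R by rewrite ltr0n.
exists (K ^+ J) => [|w h hw hh]; first exact: exprn_ege1.
have Lw := L_gt0 hw.
have hj j : (j <= J)%N -> cabs (ofR (j%:R / J%:R) * h) <= beta / L w.
  move=> jJ; rewrite cabsM cabs_ofR ger0_norm ?divr_ge0//.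
  rewrite (le_trans _ hh)// ler_piMl ?cabs_ge0// ler_pdivrMr// mul1r ler_nat//.
have step j : (j <= J)%N ->
    max_index m0 (w + (ofR (j%:R / J%:R) * h) *: b) <= K ^+ j * max_index m0 w.
  elim: j => [|j IH] jJ; first by rewrite mul0r mul0r scale0r addr0 expr0 mul1r.
  have hwj := unit_ball_shift hw (hj j (ltnW jJ)).
  have Lwj := L_gt0 hwj.
  have /andP[_ hL] := L_ratio hw (hj j (ltnW jJ)).
  have -> : w + (ofR (j.+1%:R / J%:R) * h) *: b =
      w + (ofR (j%:R / J%:R) * h) *: b + (ofR J%:R^-1 * h) *: b.
    rewrite -addrA -scalerDl -mulrDl -ofRD -[j.+1%:R]natr1.
    by rewrite [(j%:R + 1) / _]mulrDl mul1r.
  apply: le_trans (max_index_step hwj _) _.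
    rewrite cabsM cabs_ofR ger0_norm ?invr_ge0 ?(ltW J0)//.
    rewrite mulrC ler_pdivrMr// (le_trans hh)//.
    rewrite ler_pdivrMr// mulrAC mulrAC -mulrA.
    rewrite mulrAC ler_pdivlMr ?mulr_gt0// mul1r.
    apply: (@le_trans _ _ (beta * (4 * (l2 * L w)))).
      by rewrite ler_pM2l// ler_pM2l.
    rewrite (_ : beta * _ = beta * (4 * l2) * L w); last by ring.
    by rewrite ler_pM2r.
  by rewrite exprS -mulrA ler_pM2l ?(lt_le_trans ltr01 K1)// IH// ltnW.
have J1 : J%:R / J%:R = 1 :> R by rewrite divff// gt_eqF.
move: (step J (leqnn J)); rewrite J1 ofR1 mul1r; exact.
Qed.
End BoundedIndex.

(** Cauchy's estimates give the factor [r^-1 ^+ k] at order [k]; [1 + r^-1] is at least 1, so its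
    m-th power dominates for every [k <= m], be [r] small or large. *)
Lemma max_index_le_circle w t0 z0 r m : w = z0 + t0 *: b -> slice b z0 t0 ->
  0 < r -> r <= beta ->
  max_index m w <= (1 + r^-1) ^+ m * circle_max b F z0 t0 (r / L w).
Proof.
move=> -> hw r0 rbeta; set w' := z0 + t0 *: b; have Lw : 0 < L w' := L_gt0 hw.
have rL0 : 0 < r / L w' by rewrite divr_gt0.
have rLb : r / L w' <= beta / L w' by rewrite ler_wpM2r// invr_ge0 ltW.
have hM h : cabs h = r / L w' -> cabs (F (w' + h *: b)) <= circle_max b F z0 t0 (r / L w').
  exact: le_circle_max.
set M := circle_max _ _ _ _ _ in hM *.
have M0 : 0 <= M.
  by apply: le_trans (hM (ofR (r / L w')) _); rewrite ?cabs_ge0// cabs_ofR gtr0_norm.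
have r1 : 1 <= 1 + r^-1 by rewrite lerDl invr_ge0 ltW.
apply: max_index_le => [|k km]; first by rewrite mulr_ge0// exprn_ge0// (le_trans ler01).
have := cauchy_estimate k rL0 (slice_expandable_beta hw rLb) (slice_expands hw) hM.
rewrite index_termE// expr_div_n mulrA => hk.
have {}hk : cabs (taylor_coef w' k) / L w' ^+ k <= r^-1 ^+ k * M.
  by rewrite exprVn [leRHS]mulrC ler_pdivlMr ?exprn_gt0// mulrAC.
apply: (le_trans hk); rewrite ler_wpM2r//.
apply: (@le_trans _ _ ((1 + r^-1) ^+ k)); last by rewrite ler_weXn2l.
by rewrite lerXn2r ?nnegrE ?lerDr ?addr_ge0 ?invr_ge0 ?(ltW r0).
Qed.

(** On the outer circle [|F|] is the index term of order 0; [max_index_chain] leads back to the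
    centre and [max_index_le_circle] from there to the inner circle. *)
Lemma bounded_index_growth : bounded_index b L F ->
  forall r1 r2 : R, 0 < r1 -> r1 < r2 -> r2 <= beta ->
     exists P1 : R, 1 <= P1 /\
       forall (z0 : CVec R n) (t0 : C), ball1 z0 -> slice b z0 t0 ->
         circle_max b F z0 t0 (r2 / L (z0 + t0 *: b)) <=
           P1 * circle_max b F z0 t0 (r1 / L (z0 + t0 *: b)).
Proof.
move=> [m0 hm0] r1 r2 r10 r12 r2b; have [l1 [l2 [l10 hL]]] := L_ratio_bounds.
have [Q Q1 hQ] := max_index_chain hm0 l10 hL.
have r11 : 1 <= (1 + r1^-1) ^+ m0 by rewrite exprn_ege1// lerDl invr_ge0 ltW.
exists (Q * (1 + r1^-1) ^+ m0); split; first exact: mulr_ege1.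
move=> z0 t0 _ ht0; set w := z0 + t0 *: b; have Lw : 0 < L w := L_gt0 ht0.
apply: (circle_max_le) => [|h hh].
  by rewrite divr_ge0// ltW// (lt_trans r10).
have hhb : cabs h <= beta / L w by rewrite hh ler_wpM2r// invr_ge0 ltW.
rewrite -index_term0 (le_trans (le_max_index _ (leq0n m0)))//.
rewrite (le_trans (hQ w h ht0 hhb))// -mulrA ler_wpM2l ?(le_trans ler01)//.
exact: (max_index_le_circle _ _ ht0 r10 (le_trans (ltW r12) r2b)).
Qed.

Lemma growth_bounded_index (P : R) : 1 <= P ->
  (forall w, ball1 w -> circle_max b F w 0 (beta / L w) <=
     P * circle_max b F w 0 (1 / L w)) -> bounded_index b L F.
Proof.
(* The factor 2 makes the Taylor remainder at most half of the maximum on the inner circle. *)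
move=> P1 hP; have [N hN] := exponential_beats_linear (2 * P) beta_gt1.
exists N => m w hw; rewrite -/(max_index N w); set A := max_index N w.
have Lw := L_gt0 hw; have P0 : 0 < P := lt_le_trans ltr01 P1.
have A0 : 0 <= A := max_index_ge0 N w.
have hs : slice b w 0 by rewrite /slice /= scale0r addr0.
have E h : w + 0 *: b + h *: b = w + h *: b by rewrite scale0r addr0.
have L0 : L (w + 0 *: b) = L w by rewrite scale0r addr0.
set M1 := circle_max b F w 0 (1 / L w); set Mb := circle_max b F w 0 (beta / L w).
have MbP : Mb <= P * M1 := hP w hw.
have onL : 1 / L w <= beta / L w by rewrite ler_wpM2r ?invr_ge0 ?(ltW Lw) ?(ltW beta_gt1).
have hM1 h : cabs h = 1 / L w -> cabs (F (w + h *: b)) <= M1.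
  by rewrite -E => hh; apply: (le_circle_max hs) => //; rewrite L0.
have hMb h : cabs h = beta / L w -> cabs (F (w + h *: b)) <= Mb.
  by rewrite -E => hh; apply: (le_circle_max hs) => //; rewrite L0.
have M10 : 0 <= M1.
  apply: le_trans (hM1 (ofR (1 / L w)) _); rewrite ?cabs_ge0//.
  by rewrite cabs_ofR ger0_norm// divr_ge0// ltW.
have r0 : 0 < beta / L w by rewrite divr_gt0.
have hexp := slice_expandable_beta hw (lexx _).
have hT k : index_term b L F k w * beta ^+ k <= P * M1.
  have := cauchy_estimate k r0 hexp (slice_expands hw) hMb.
  rewrite index_termE// expr_div_n mulrA mulrAC => hk.
  exact: le_trans hk MbP.
(* The remainder, at most [M1 / 2], is absorbed on the left. *)
have M1A : M1 <= 2 * (N%:R * A).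
  have : M1 <= N%:R * A + N.+1%:R * Mb * beta^-1 ^+ N.
    apply: (circle_max_le) => [|h hh]; first by rewrite divr_ge0// ltW.
    rewrite E; have hhb : cabs h <= beta / L w by rewrite hh.
    have := taylor_remainder N r0 hexp (slice_expands hw) hMb hhb.
    have -> : cabs h / (beta / L w) = beta^-1.
      by rewrite hh; field; rewrite !gt_eqF.
    move=> rem.
    apply: (le_trans (cabs_le_dist _ (\sum_(k < N) taylor_coef w k * h ^+ k))).
    apply: lerD => //; apply: (le_trans (cabs_sum _ _ _)).
    rewrite (_ : N%:R * A = \sum_(k < N) A); last by rewrite sumr_const card_ord mulr_natl.
    apply: ler_sum => k _; apply: le_trans (le_max_index w (ltnW (ltn_ord k))).
    by rewrite index_termE// cabsM cabsX hh expr_div_n expr1n div1r.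
  have : N.+1%:R * Mb * beta^-1 ^+ N <= M1 / 2.
    rewrite exprVn ler_pdivrMr ?exprn_gt0//.
    apply: (@le_trans _ _ (N.+1%:R * (P * M1))); first by rewrite ler_wpM2l.
    have := ler_wpM2l M10 hN; lra.
  lra.
have [mN|Nm] := leqP m N; first exact: le_max_index.
have bm : 0 < beta ^+ m by rewrite exprn_gt0.
rewrite -(ler_pM2r bm) (le_trans (hT m))//.
(* The choice of [N] serves again: [2 * P * N <= beta ^+ N <= beta ^+ m]. *)
apply: (@le_trans _ _ (P * (2 * (N%:R * A)))); first by rewrite ler_pM2l.
have bNm : beta ^+ N <= beta ^+ m.
  by apply: ler_weXn2l; [exact: ltW|exact: ltnW].
have := ler_wpM2l A0 (le_trans hN bNm).
have : 0 <= A * P by rewrite mulr_ge0// ltW.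
rewrite -[N.+1%:R]natr1; lra.
Qed.
End DirectionalIndex.

Theorem theorem8 (R : realType) (n : nat) (beta : R) (b : CVec R n)
    (L : CVec R n -> R) (F : CVec R n -> Cplx R)
    (beta_gt1 : 1 < beta) (b_neq0 : b != 0) (LQ : Qclass b beta L)
    (F_analytic : analytic_in (unit_ball R n) F) :
  bounded_index b L F <->
  (forall r1 r2 : R, 0 < r1 -> r1 < r2 -> r2 <= beta ->
     exists P1 : R, 1 <= P1 /\
       forall (z0 : CVec R n) (t0 : Cplx R),
         unit_ball R n z0 -> slice b z0 t0 ->
         circle_max b F z0 t0 (r2 / L (z0 + t0 *: b)) <=
           P1 * circle_max b F z0 t0 (r1 / L (z0 + t0 *: b))).
Proof.
split=> [|growth]; first exact: bounded_index_growth.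
(* The radii 1 and [beta] are admissible since [1 < beta]. *)
have [P [P1 hP]] := growth _ _ ltr01 beta_gt1 (lexx beta).
apply: (growth_bounded_index beta_gt1 LQ F_analytic P1) => w hw.
have hs : slice b w 0 by rewrite /slice /= scale0r addr0.
by have := hP w 0 hw hs; rewrite scale0r addr0.
Qed.
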